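(* Let $f$ be a Rademacher random multiplicative function, $\mathcal{M}(x)=\sum_{n\leq x}f(n)$, and let $\lambda:[1,\infty)\to\mathbb{R}$ be any function such that $\int_1^\infty \frac{|\lambda(u)|}{u^{3/2}}\,du<\infty$. Then, almost surely, $\mathcal{M}(x)+\lambda(x)$ changes sign infinitely often as $x\to\infty$.
   Context: A Rademacher random multiplicative function is defined as follows: $(f(p))_{p\text{ prime}}$ are independent random variables, each taking the values $+1$ and $-1$ with probability $1/2$; $f$ is extended to the positive integers by setting $f(1)=1$, $f(n)=\prod_{p\mid n}f(p)$ if $n$ is squarefree, and $f(n)=0$ if $n$ is not squarefree. A real function $M(x)$ is said to change sign infinitely often as $x\to\infty$ if neither of the statements ''$M(x)\geq 0$ for all sufficiently large $x$'' nor ''$M(x)\leq 0$ for all sufficiently large $x$'' holds. *)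

(* Defs.v *)
From mathcomp Require Import all_boot all_order all_algebra finmap.
From mathcomp Require Import all_classical all_reals all_analysis.
Import Order.TTheory GRing.Theory Num.Theory.
Import numFieldNormedType.Exports.

Set Implicit Arguments.
Unset Strict Implicit.
Unset Printing Implicit Defensive.

Local Open Scope classical_set_scope.
Local Open Scope ring_scope.

Definition mutually_independent d (T : measurableType d) (R : realType)
    (P : probability T R) (I : choiceType) (D : set I)
    (X : I -> {RV P >-> R}) : Prop :=
  forall (J : {fset I}) (B : I -> set R),
    [set` J] `<=` D ->
    (forall i, i \in J -> measurable (B i)) ->
    P (\bigcap_(i in [set` J]) (X i @^-1` B i)) =
      (\prod_(i <- J) P (X i @^-1` B i))%E.

Definition squarefree (n : nat) : Prop :=
  forall k : nat, (k ^ 2 %| n)%N -> k = 1%N.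

(* The value at 0 plays no role and is left unconstrained. *)
Record rademacher_rmf d (T : measurableType d) (R : realType)
    (P : probability T R) (f : nat -> {RV P >-> R}) : Prop := {
  rmf_indep : mutually_independent [set p | prime p] f ;
  rmf_prime_pos : forall p, prime p ->
    P (f p @^-1` [set 1]) = (2^-1)%:E ;
  rmf_prime_neg : forall p, prime p ->
    P (f p @^-1` [set -1]) = (2^-1)%:E ;
  rmf_one : forall t, f 1%N t = 1 ;
  rmf_squarefree : forall n t, squarefree n ->
    f n t = \prod_(p <- primes n) f p t ;
  rmf_nonsquarefree : forall n t, (0 < n)%N -> ~ squarefree n -> f n t = 0
}.

Definition summatory (R : realType) (a : nat -> R) (x : R) : R :=
  \sum_(1 <= n < (Num.truncn x).+1) a n.

Definition changes_sign_io (R : realType) (g : R -> R) : Prop :=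
  ~ (\forall x \near +oo, 0 <= g x) /\ ~ (\forall x \near +oo, g x <= 0).

(* Main.v *)
(* If [M + lambda] keeps a constant sign near infinity, then comparing
   [\int M(x) x^(-s-1) dx = F(s)/s] as [s] decreases to 1/2 (along values of [s]
   where the Euler product [F(s)], a positive variable of mean 1, stays
   bounded) shows that [\int |M(x)| x^(-3/2) dx] is finite, hence that
   [|F(s + it)| <= C (1 + |t|)] uniformly for [s > 1/2].  Almost surely the
   latter fails: [log |F(s + it)|] is, up to a bounded error,
   [\sum_p f(p) cos(t log p) / p^s - 1/2 \sum_p cos(2 t log p) / p^(2s)]; for a
   suitable [t <= L := \sum_p p^(-2s)] the second sum is bounded, while the
   first one has variance about [L/2] and so exceeds a fixed multiple of
   [sqrt L], which beats [log (C (1 + L))], with probability bounded below.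
   Repeating this on disjoint blocks of primes makes the bound fail almost
   surely.

   Integrals against the step function [M] are replaced by sums over integers,
   infinite products by finite ones, and expectations by averages [avg] over
   finitely many signs; the probability space only enters through the
   probabilities of events that depend on finitely many signs. *)
Require Import Defs.
From mathcomp Require Import all_boot all_order all_algebra finmap.
From mathcomp Require Import all_classical all_reals all_analysis.
From mathcomp Require Import ring lra.
Import Order.TTheory GRing.Theory Num.Theory.
Import numFieldNormedType.Exports.

Local Open Scope classical_set_scope.
Local Open Scope ring_scope.

Set Implicit Arguments.
Unset Strict Implicit.
Unset Printing Implicit Defensive.

(** * Averages over finitely many signs *)

Definition update (b : nat -> bool) (p : nat) (v : bool) : nat -> bool :=
  fun q => if q == p then v else b q.

Lemma updateC (b : nat -> bool) (p q : nat) (v w : bool) : p != q ->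
  update (update b p v) q w = update (update b q w) p v.
Proof.
move=> pq; apply/funext => r; rewrite /update.
by case: (eqVneq r q) => [->|//]; rewrite eq_sym (negbTE pq).
Qed.

Definition eps (R : realType) (b : nat -> bool) (p : nat) : R :=
  if b p then 1 else -1.

Lemma eps_sqr (R : realType) (b : nat -> bool) (p : nat) : eps R b p ^+ 2 = 1.
Proof. by rewrite /eps; case: (b p); rewrite ?sqrrN expr1n. Qed.

Definition mean (R : realType) (p : nat) (h : (nat -> bool) -> R) :
    (nat -> bool) -> R :=
  fun b => (h (update b p true) + h (update b p false)) / 2.

(** Signs outside [l] remain parameters of the result, so this is a conditional expectation given
    those signs. *)
Fixpoint avg (R : realType) (l : seq nat) (h : (nat -> bool) -> R) :
    (nat -> bool) -> R :=
  if l is p :: l' then avg l' (mean p h) else h.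

Definition supported (S : Type) (l : seq nat) (h : (nat -> bool) -> S) : Prop :=
  forall b b', (forall p, p \in l -> b p = b' p) -> h b = h b'.

Definition avoids (S : Type) (l : seq nat) (h : (nat -> bool) -> S) : Prop :=
  forall b b', (forall p, p \notin l -> b p = b' p) -> h b = h b'.

Section Average.
Variable R : realType.
Implicit Types (h k : (nat -> bool) -> R) (l : seq nat) (b : nat -> bool).

Lemma avg_eq l h k : (forall b, h b = k b) -> forall b, avg l h b = avg l k b.
Proof. by move=> /funext ->. Qed.

Lemma avg_cat l1 l2 h b : avg (l1 ++ l2) h b = avg l2 (avg l1 h) b.
Proof. by elim: l1 h => //= p l IH h; rewrite IH. Qed.

Lemma avgD l h k b : avg l (fun b => h b + k b) b = avg l h b + avg l k b.
Proof.
elim: l h k b => //= p l IH h k b; rewrite -IH; apply: avg_eq => {}b.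
by rewrite /mean; lra.
Qed.

Lemma avg_scale l h (c : R) b : avg l (fun b => c * h b) b = c * avg l h b.
Proof.
elim: l h b => //= p l IH h b; rewrite -IH; apply: avg_eq => {}b.
by rewrite /mean; lra.
Qed.

Lemma avg_cst l (c : R) b : avg l (fun=> c) b = c.
Proof.
elim: l c b => //= p l IH c b; rewrite -[RHS](IH c b); apply: avg_eq => {}b.
by rewrite /mean; lra.
Qed.

Lemma avg_ge0 l h b : (forall b, 0 <= h b) -> 0 <= avg l h b.
Proof.
elim: l h b => //= p l IH h b h0; apply: IH => {}b.
by rewrite /mean divr_ge0// addr_ge0.
Qed.

Lemma avg_le l h k b : (forall b, h b <= k b) -> avg l h b <= avg l k b.
Proof.
move=> hk; rewrite -subr_ge0 -[_ - _]addr0 -mulN1r -avg_scale addr0 -avgD.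
by apply: avg_ge0 => {}b; rewrite mulN1r subr_ge0.
Qed.

(** Each [mean] over a sign of [l] leaves [k] untouched; this is the form in which independence of
    disjoint blocks of primes is used. *)
Lemma avg_mulr l h k b : avoids l k ->
  avg l (fun b => h b * k b) b = avg l h b * k b.
Proof.
elim: l h b => //= p l IH h b kl.
rewrite -IH; last by move=> b1 b2 e; apply: kl => q; rewrite inE negb_or => /andP[_ /e].
apply: avg_eq => {}b; rewrite /mean.
have kE v : k (update b p v) = k b.
  by apply: kl => q; rewrite inE negb_or /update => /andP[/negbTE -> _].
by rewrite !kE; field.
Qed.

Lemma avg_mean p l h b : p \notin l -> avg l (mean p h) b = mean p (avg l h) b.
Proof.
elim: l h b => //= q l IH h b; rewrite inE negb_or => /andP[pq pl].
rewrite -IH//; apply: avg_eq => {}b; rewrite /mean.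
by rewrite !(updateC _ _ _ pq); lra.
Qed.

Definition prob l (Q : (nat -> bool) -> bool) b : R :=
  avg l (fun b => (Q b)%:R) b.

Lemma prob_le l (Q Q' : (nat -> bool) -> bool) b :
  (forall b, Q b -> Q' b) -> prob l Q b <= prob l Q' b.
Proof.
move=> QQ'; apply: avg_le => {}b; rewrite ler_nat.
by have := QQ' b; case: (Q b) => // ->.
Qed.

Lemma probU l (Q Q' : (nat -> bool) -> bool) b :
  prob l (fun b => Q b || Q' b) b <= prob l Q b + prob l Q' b.
Proof.
rewrite /prob -avgD; apply: avg_le => {}b; rewrite -natrD ler_nat.
by case: (Q b) (Q' b) => -[].
Qed.

Lemma markov l (Q : (nat -> bool) -> bool) h b :
  (forall b, 0 <= h b) -> (forall b, Q b -> 1 <= h b) ->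
  prob l Q b <= avg l h b.
Proof.
move=> h0 Qh; apply: avg_le => {}b; have := Qh b; have := h0 b.
by case: (Q b) => //= _; apply.
Qed.

End Average.

(** * Squarefree numbers and Walsh sums *)

Definition all_prime (l : seq nat) : Prop := forall p, p \in l -> prime p.

(** For distinct primes this enumerates, once each, the squarefree numbers composed of them; the
    recursion separates those divisible by the head, to match averaging one sign at a time. *)
Fixpoint sqfree_over (l : seq nat) : seq nat :=
  if l is p :: l' then sqfree_over l' ++ map (muln p) (sqfree_over l')
  else [:: 1%N].

(** For squarefree [n] these are the Walsh functions of the signs. At a positive [n] that is not
    squarefree the value is that at the radical; [rmf] replaces it by 0. *)
Definition phi (R : realType) (b : nat -> bool) (n : nat) : R :=
  \prod_(p <- primes n) eps R b p.

Lemma sqfree_over_gt0 l n : all_prime l -> n \in sqfree_over l -> (0 < n)%N.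
Proof.
elim: l n => [|p l IH] n lP /=; first by rewrite inE => /eqP ->.
have lP' : all_prime l by move=> q ql; apply: lP; rewrite inE ql orbT.
rewrite mem_cat => /orP[/IH|/mapP[m ml ->]]; first exact.
by rewrite muln_gt0 (IH m)// prime_gt0// lP ?mem_head.
Qed.

Lemma primes_sqfree_over l n : all_prime l -> n \in sqfree_over l ->
  {subset primes n <= l}.
Proof.
elim: l n => [|p l IH] n lP /=; first by rewrite inE => /eqP ->.
have lP' : all_prime l by move=> q ql; apply: lP; rewrite inE ql orbT.
rewrite mem_cat => /orP[nl q /(IH _ lP' nl)|/mapP[m ml ->] q].
  by rewrite inE => ->; rewrite orbT.
have pp : prime p by apply: lP; rewrite mem_head.
have p0 := prime_gt0 pp; have m0 := sqfree_over_gt0 lP' ml.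
rewrite (primesM _ p0 m0) primes_prime// !inE.
by move=> /orP[-> //|/(IH _ lP' ml) ->]; rewrite orbT.
Qed.

Lemma ndvd_sqfree_over p l n : prime p -> all_prime l -> p \notin l ->
  n \in sqfree_over l -> ~~ (p %| n)%N.
Proof.
move=> pp lP pl nl; apply: contra pl => pn; apply: (primes_sqfree_over lP nl).
by rewrite mem_primes pp pn (sqfree_over_gt0 lP nl).
Qed.

Lemma uniq_sqfree_over l : all_prime l -> uniq l -> uniq (sqfree_over l).
Proof.
elim: l => //= p l IH lP /andP[pl ul].
have lP' : all_prime l by move=> q ql; apply: lP; rewrite inE ql orbT.
have pp : prime p by apply: lP; rewrite mem_head.
rewrite cat_uniq IH// map_inj_uniq ?IH//=; last first.
  by move=> m n /eqP; rewrite eqn_pmul2l ?prime_gt0// => /eqP.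
rewrite andbT; apply/hasPn => _ /mapP[m ml ->]; apply/negP.
by move=> /(ndvd_sqfree_over pp lP' pl); rewrite dvdn_mulr.
Qed.

Lemma squarefree_gt0 n : squarefree n -> (0 < n)%N.
Proof. by case: n => // /(_ 0%N); rewrite dvdn0 => /(_ isT). Qed.

Lemma squarefree_dvd m n : (m %| n)%N -> squarefree n -> squarefree m.
Proof. by move=> mn sn k km; apply: sn; apply: dvdn_trans mn. Qed.

Lemma squarefreeMp p n : prime p -> ~~ (p %| n)%N -> squarefree n ->
  squarefree (p * n).
Proof.
move=> pp pn sn k kpn; have [pk|pk] := boolP (p %| k)%N.
  have : (p ^ 2 %| p * n)%N by apply: dvdn_trans kpn; rewrite dvdn_exp2r.
  by rewrite expnS expn1 dvdn_pmul2l ?prime_gt0// (negbTE pn).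
apply: sn; rewrite -(@Gauss_dvdr _ p)// coprimeXl// coprime_sym prime_coprime//.
Qed.

Lemma mem_sqfree_over l n : all_prime l -> uniq l ->
  (n \in sqfree_over l) <-> (squarefree n /\ {subset primes n <= l}).
Proof.
elim: l n => [|p l IH] n lP /=.
  rewrite inE => _; split=> [/eqP ->|[sn nl]].
    split=> // k; rewrite dvdn1 => /eqP; case: k => [|[|k]]//.
  apply/eqP; have := squarefree_gt0 sn; rewrite leq_eqVlt => /orP[/eqP ->//|n1].
  by have := nl (pdiv n); rewrite mem_primes pdiv_prime// pdiv_dvd ltnW// => /(_ isT).
move=> /andP[pl ul].
have lP' : all_prime l by move=> q ql; apply: lP; rewrite inE ql orbT.
have pp : prime p by apply: lP; rewrite mem_head.
split=> [npl|[sn nl]].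
  split; last exact: (@primes_sqfree_over (p :: l)).
  move: npl; rewrite mem_cat => /orP[/(IH _ lP' ul)[]//|/mapP[m ml ->]].
  apply: squarefreeMp => //; first exact: (ndvd_sqfree_over pp lP' pl).
  by have /(IH _ lP' ul)[] := ml.
rewrite mem_cat; have [pn|pn] := boolP (p %| n)%N; last first.
  apply/orP; left; apply/(IH _ lP' ul); split=> // q qn.
  have := nl _ qn; rewrite inE => /orP[/eqP qp|//].
  by move: qn pn; rewrite mem_primes qp => /and3P[_ _ ->].
apply/orP; right; apply/mapP; exists (n %/ p)%N; last by rewrite mulnC divnK.
have smn : squarefree (n %/ p) by apply: squarefree_dvd sn; apply: dvdn_div.
apply/(IH _ lP' ul); split=> // q qnp.
have : q \in primes n.
  move: qnp; rewrite !mem_primes (squarefree_gt0 sn) => /and3P[-> _ qd] /=.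
  by apply: dvdn_trans qd _; apply: dvdn_div.
move=> /nl; rewrite inE => /orP[/eqP qp|//].
move: qnp; rewrite qp mem_primes => /and3P[_ _ pnp].
have /sn p1 : (p ^ 2 %| n)%N by rewrite -(divnK pn) expnS expn1 dvdn_pmul2r ?prime_gt0.
by move: pp; rewrite p1.
Qed.

Section Walsh.
Variable R : realType.
Implicit Types (l : seq nat) (b : nat -> bool).

Lemma phi_mulp b p n : prime p -> (0 < n)%N -> ~~ (p %| n)%N ->
  phi R b (p * n) = eps R b p * phi R b n.
Proof.
move=> pp n0 pn; rewrite /phi -(@big_cons _ _ *%R _ p (primes n) xpredT (eps R b)).
apply: perm_big; apply: uniq_perm; rewrite /= ?primes_uniq//.
  by rewrite andbT mem_primes (negbTE pn) !andbF.
by move=> q; rewrite (primesM _ (prime_gt0 pp) n0) primes_prime// !inE.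
Qed.

Lemma phi_update b p v n : ~~ (p %| n)%N -> phi R (update b p v) n = phi R b n.
Proof.
move=> pn; apply: eq_big_seq => q; rewrite mem_primes => /and3P[_ _ qn].
by rewrite /eps /update; case: eqVneq => // qp; rewrite -qp qn in pn.
Qed.

Definition walsh l (a : nat -> R) b : R :=
  \sum_(n <- sqfree_over l) a n * phi R b n.

Lemma walsh_nil a b : walsh [::] a b = a 1%N.
Proof. by rewrite /walsh /= big_seq1 /phi big_nil mulr1. Qed.

Lemma walsh_cons p l a b : prime p -> all_prime l -> p \notin l ->
  walsh (p :: l) a b =
  walsh l a b + eps R b p * walsh l (fun n => a (p * n)%N) b.
Proof.
move=> pp lP pl; rewrite /walsh /= big_cat /= big_map; congr (_ + _).
rewrite mulr_sumr big_seq [RHS]big_seq; apply: eq_bigr => n nl.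
rewrite phi_mulp// ?(ndvd_sqfree_over pp lP pl nl)//; last exact: sqfree_over_gt0 nl.
by rewrite mulrCA.
Qed.

Lemma walsh_update p v l a b : prime p -> all_prime l -> p \notin l ->
  walsh l a (update b p v) = walsh l a b.
Proof.
move=> pp lP pl; rewrite /walsh big_seq [RHS]big_seq; apply: eq_bigr => n nl.
by rewrite phi_update// (ndvd_sqfree_over pp lP pl nl).
Qed.

Lemma all_prime_cons p l : all_prime (p :: l) -> prime p /\ all_prime l.
Proof.
by move=> pl; split=> [|q ql]; apply: pl; rewrite ?mem_head// inE ql orbT.
Qed.

(** Parseval identity for the Walsh functions: averaging one sign [e] turns [(A + e B)^2] into
    [A^2 + B^2], which matches the splitting of the index set by divisibility by that prime. *)
Lemma avg_walsh_sqr l a b : all_prime l -> uniq l ->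
  avg l (fun b => walsh l a b ^+ 2) b = \sum_(n <- sqfree_over l) a n ^+ 2.
Proof.
elim: l a b => [|p l IH] a b; first by rewrite /= big_seq1 walsh_nil.
move=> /all_prime_cons[pp lP] /= /andP[pl ul].
rewrite big_cat big_map /= -(IH a b)// -(IH (fun n => a (p * n)%N) b)// -avgD.
apply: avg_eq => {}b; rewrite /mean !walsh_cons// !walsh_update//.
by rewrite /eps /update eqxx; lra.
Qed.

Lemma walsh_mult l (u : nat -> R) b : all_prime l -> uniq l ->
  u 1%N = 1 -> (forall m n, (0 < m)%N -> (0 < n)%N -> u (m * n)%N = u m * u n) ->
  walsh l u b = \prod_(p <- l) (1 + eps R b p * u p).
Proof.
move=> lP ul u1 uM; elim: l lP ul => [|p l IH]; first by rewrite walsh_nil big_nil.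
move=> /all_prime_cons[pp lP] /= /andP[pl ul].
rewrite big_cons walsh_cons// -IH// mulrDl mul1r; congr (_ + _).
rewrite -mulrA; congr (_ * _); rewrite /walsh mulr_sumr big_seq [RHS]big_seq.
apply: eq_bigr => n nl.
by rewrite uM ?(prime_gt0 pp) ?(sqfree_over_gt0 lP nl)// mulrA.
Qed.

(** Here [u + i v] is completely multiplicative, so its Walsh sum is the Euler product of the
    factors [1 + e (u + i v)]; as [e^2 = 1], such a factor has squared modulus
    [(1 + e u)^2 + v^2]. *)
Lemma walsh_mult2 l (u v : nat -> R) b : all_prime l -> uniq l ->
  u 1%N = 1 -> v 1%N = 0 ->
  (forall m n, (0 < m)%N -> (0 < n)%N -> u (m * n)%N = u m * u n - v m * v n) ->
  (forall m n, (0 < m)%N -> (0 < n)%N -> v (m * n)%N = u m * v n + v m * u n) ->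
  walsh l u b ^+ 2 + walsh l v b ^+ 2 =
  \prod_(p <- l) ((1 + eps R b p * u p) ^+ 2 + v p ^+ 2).
Proof.
move=> lP ul u1 v1 uM vM; elim: l lP ul => [|p l IH].
  by rewrite !walsh_nil big_nil u1 v1 => _ _; ring.
move=> /all_prime_cons[pp lP] /= /andP[pl ul].
rewrite big_cons !walsh_cons// -IH//.
have -> : walsh l (fun n => u (p * n)%N) b = u p * walsh l u b - v p * walsh l v b.
  rewrite /walsh !mulr_sumr -sumrB big_seq [RHS]big_seq; apply: eq_bigr => n nl.
  by rewrite uM ?(prime_gt0 pp) ?(sqfree_over_gt0 lP nl)//; ring.
have -> : walsh l (fun n => v (p * n)%N) b = u p * walsh l v b + v p * walsh l u b.
  rewrite /walsh !mulr_sumr -big_split big_seq [RHS]big_seq; apply: eq_bigr => n nl /=.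
  by rewrite vM ?(prime_gt0 pp) ?(sqfree_over_gt0 lP nl)//; ring.
by rewrite /eps; case: (b p); ring.
Qed.

(** * Partial sums of the multiplicative function as Walsh sums *)

Definition rmf b (n : nat) : R := if `[< squarefree n >] then phi R b n else 0.

Definition psum b (n : nat) : R := \sum_(1 <= k < n.+1) rmf b k.

Lemma sum_rmf l X (a : nat -> R) b : all_prime l -> uniq l ->
  (forall p, prime p -> (p <= X)%N -> p \in l) ->
  \sum_(1 <= n < X.+1) a n * rmf b n =
  walsh l (fun n => if (n <= X)%N then a n else 0) b.
Proof.
move=> lP ul lX; rewrite /walsh.
have -> : \sum_(1 <= n < X.+1) a n * rmf b n =
   \sum_(1 <= n < X.+1 | `[< squarefree n >]) a n * phi R b n.
  rewrite [RHS]big_mkcond; apply: eq_bigr => n _; rewrite /rmf.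
  by case: ifP => //; rewrite mulr0.
have -> : \sum_(n <- sqfree_over l) (if (n <= X)%N then a n else 0) * phi R b n =
   \sum_(n <- sqfree_over l | (n <= X)%N) a n * phi R b n.
  by rewrite [RHS]big_mkcond; apply: eq_bigr => n _; case: ifP => //; rewrite mul0r.
rewrite -big_filter -[RHS]big_filter; apply: perm_big; apply: uniq_perm.
- by rewrite filter_uniq// iota_uniq.
- by rewrite filter_uniq// uniq_sqfree_over.
move=> n; rewrite !mem_filter mem_index_iota ltnS.
apply/andP/andP => [[/asboolP sn /andP[n0 nX]]|[nX nl]].
  split=> //; apply/(mem_sqfree_over _ lP ul); split=> // p.
  rewrite mem_primes => /and3P[pp _ pn]; apply: lX => //.
  by apply: leq_trans nX; apply: dvdn_leq.
have /(mem_sqfree_over _ lP ul)[sn _] := nl.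
by split; [exact/asboolP | rewrite (squarefree_gt0 sn) nX].
Qed.

End Walsh.

(** * Divergence of the sum of the reciprocals of the primes *)

Definition primes_in (N X : nat) : seq nat :=
  [seq p <- index_iota N.+1 X.+1 | prime p].

Lemma mem_primes_in N X p :
  (p \in primes_in N X) = [&& prime p, (N < p)%N & (p <= X)%N].
Proof. by rewrite mem_filter mem_index_iota ltnS. Qed.

Lemma primes_in_prime N X p : p \in primes_in N X -> prime p.
Proof. by rewrite mem_primes_in => /andP[]. Qed.

Lemma primes_in_uniq N X : uniq (primes_in N X).
Proof. by rewrite filter_uniq// iota_uniq. Qed.

Section PrimeSum.
Variable R : realType.

Lemma ler_sum_uniq_sub (I : eqType) (s s' : seq I) (F : I -> R) :
  uniq s -> uniq s' -> {subset s <= s'} -> (forall i, 0 <= F i) ->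
  \sum_(i <- s) F i <= \sum_(i <- s') F i.
Proof.
move=> us us' ss' F0; rewrite [leRHS](bigID (mem s)) /=.
have -> : \sum_(i <- s) F i = \sum_(i <- s' | i \in s) F i.
  rewrite -[RHS]big_filter; apply: perm_big; apply: uniq_perm => //.
    by rewrite filter_uniq.
  by move=> i; rewrite mem_filter; case: (boolP (i \in s)) => // /ss' ->.
by rewrite lerDl; apply: sumr_ge0.
Qed.

Let sieved (X : nat) (l : seq nat) : R :=
  \sum_(1 <= n < X.+1 | all (fun p => ~~ (p %| n)%N) l) n%:R^-1.

(** The discarded [n] are of the form [p m] with [m <= X] again divisible by no prime of [l], so
    their reciprocals add up to at most [sieved X l / p]. *)
Let sieved_cons X p l : prime p -> all prime l -> p \notin l ->
  sieved X l * (1 - p%:R^-1) <= sieved X (p :: l).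
Proof.
move=> pp lP pl; rewrite mulrBr mulr1 lerBlDr /sieved.
rewrite [leLHS](bigID (fun n => ~~ (p %| n)%N)) /=.
under eq_bigl do rewrite andbC.
rewrite lerD2l mulr_suml -big_filter -[leRHS]big_filter.

set s := [seq _ <- _ | _ && _]; set s' := [seq _ <- _ | _].
pose t := [seq (n %/ p)%N | n <- s].
have st n : n \in s -> [/\ (0 < n)%N, (n <= X)%N, all (fun q => ~~ (q %| n)%N) l & (p %| n)%N].
  by rewrite mem_filter mem_index_iota negbK ltnS => /andP[/andP[-> ->] /andP[-> ->]].
have -> : \sum_(i <- s) i%:R^-1 = \sum_(m <- t) m%:R^-1 / p%:R :> R.
  rewrite big_map big_seq [RHS]big_seq; apply: eq_bigr => n /st[_ _ _ pn].
  by rewrite -{1}(divnK pn) natrM invfM.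
apply: ler_sum_uniq_sub.
- rewrite map_inj_in_uniq ?filter_uniq ?iota_uniq// => m n /st[_ _ _ pm] /st[_ _ _ pn].
  by move=> mn; rewrite -(divnK pm) mn divnK.
- by rewrite filter_uniq// iota_uniq.
- move=> m /mapP[n /st[n0 nX /allP nl pn] ->]; rewrite mem_filter mem_index_iota ltnS.
  apply/andP; split; last first.
    by rewrite divn_gt0 ?prime_gt0// dvdn_leq//= (leq_trans (leq_div _ _)).
  apply/allP => q ql; apply: contra (nl _ ql) => qn.
  by apply: dvdn_trans qn _; apply: dvdn_div.
- by move=> i; rewrite divr_ge0.
Qed.

Let sieved_prod X l : all prime l -> uniq l ->
  sieved X [::] * \prod_(p <- l) (1 - p%:R^-1) <= sieved X l.
Proof.
elim: l => [|p l IH]; first by rewrite big_nil mulr1.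
move=> /= /andP[pp lP] /andP[pl ul]; rewrite big_cons mulrCA mulrC.
apply: le_trans (sieved_cons X pp lP pl); rewrite ler_wpM2r ?IH//.
by rewrite subr_ge0 invf_le1 ?ler1n ?ltr0n prime_gt0.
Qed.

Lemma expRN2_le (y : R) : 0 <= y -> y <= 2^-1 -> expR (- (2 * y)) <= 1 - y.
Proof.
move=> y0 y1; rewrite expRN.
have := expR_ge1Dx (2 * y) => h.
have p : 0 < 1 + 2 * y by lra.
apply: (@le_trans _ _ (1 + 2 * y)^-1); first by rewrite lef_pV2// posrE ?expR_gt0.
by rewrite -[(1 + 2 * y)^-1]mul1r ler_pdivrMr//; nra.
Qed.

(** Sieving by every prime up to [X] leaves only [n = 1], so the harmonic sum times the product of
    the [1 - 1/p] is at most 1; that product is bounded below by [expRN2_le]. *)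
Lemma harmonic_le_expR (X : nat) :
  \sum_(1 <= n < X.+1) n%:R^-1 <=
  expR (2 * \sum_(p <- primes_in 0 X) p%:R^-1) :> R.
Proof.
have lP : all prime (primes_in 0 X) by apply/allP => p /primes_in_prime.
have := sieved_prod X lP (primes_in_uniq _ _); rewrite {1}/sieved /=.
have -> : \sum_(1 <= n < X.+1 | true) n%:R^-1 = \sum_(1 <= n < X.+1) n%:R^-1 :> R by [].
set H := \sum_(1 <= n < _) _.
have H0 : 0 <= H by apply: sumr_ge0 => i _; rewrite invr_ge0.
have s1 : sieved X (primes_in 0 X) <= 1.
  apply: (@le_trans _ _ (\sum_(n <- [:: 1%N]) n%:R^-1)); last by rewrite big_seq1 invr1.
  rewrite /sieved -big_filter; apply: ler_sum_uniq_sub => //.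
    by rewrite filter_uniq// iota_uniq.
  move=> n; rewrite mem_filter mem_index_iota ltnS inE => /andP[/allP nl /andP[n0 nX]].
  rewrite eqn_leq n0 andbT leqNgt; apply/negP => n1.
  have := nl (pdiv n); rewrite mem_primes_in pdiv_prime// pdiv_dvd pdiv_gt0.
  by rewrite (leq_trans (pdiv_leq n0) nX) => /(_ isT).
have p1 : expR (- (2 * \sum_(p <- primes_in 0 X) p%:R^-1)) <=
   \prod_(p <- primes_in 0 X) (1 - p%:R^-1) :> R.
  rewrite -mulrN -sumrN mulr_sumr expR_sum big_seq [leRHS]big_seq.
  apply: ler_prod => p /primes_in_prime pp; rewrite expR_ge0 /= mulrN.
  by apply: expRN2_le; rewrite ?invr_ge0// lef_pV2 ?posrE ?ltr0n ?prime_gt0// ler_nat prime_gt1.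
move=> h; have := le_trans (ler_wpM2l H0 p1) (le_trans h s1).
by rewrite expRN ler_pdivrMr ?expR_gt0// mul1r.
Qed.

Lemma harmonic_sum_dvg (K : R) : exists X, K <= \sum_(1 <= n < X.+1) n%:R^-1.
Proof.
apply/not_existsP => h; apply: (@dvg_harmonic R); apply: nondecreasing_is_cvgn.
  apply/nondecreasing_seqP => n; rewrite /series /= big_nat_recr//= lerDl.
  exact: harmonic_ge0.
exists K => _ [n _ <-]; have /negP := h n; rewrite -ltNge => /ltW.
by rewrite big_add1.
Qed.

Lemma sum_primes_in_cat (F : nat -> R) N X : (N <= X)%N ->
  \sum_(p <- primes_in 0 X) F p =
  \sum_(p <- primes_in 0 N) F p + \sum_(p <- primes_in N X) F p.
Proof. by move=> NX; rewrite !big_filter (@big_cat_nat _ _ _ N.+1). Qed.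

Lemma sum_inv_primes_dvg (N : nat) (K : R) :
  exists2 X, (N <= X)%N & K <= \sum_(p <- primes_in N X) p%:R^-1.
Proof.
pose S X : R := \sum_(p <- primes_in 0 X) p%:R^-1.
have [X HX] := harmonic_sum_dvg (expR (2 * (`|K| + 1 + S N))).
have := le_trans HX (harmonic_le_expR X); rewrite ler_expR ler_pM2l// => KX.
have K0 := ler_norm K; have K1 := normr_ge0 K.
have [NX|/ltnW XN] := leqP N X.
  by exists X => //; move: KX; rewrite (sum_primes_in_cat _ NX) /S; lra.
exists N => //; exfalso.
have := sum_primes_in_cat (fun p => p%:R^-1) XN.
have : 0 <= \sum_(p <- primes_in X N) p%:R^-1 :> R.
  by apply: sumr_ge0 => p _; rewrite invr_ge0.
by move: KX; rewrite /S; lra.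
Qed.

End PrimeSum.

(** * The weights $n^{-s-it}$ *)

Section DirichletWeights.
Variable R : realType.
Implicit Types (s t a x y : R) (n X Y : nat).

(* [dcos s t n] and [- dsin s t n] are the real and imaginary parts of
   $n^{-(s + it)}$, and [npow s n] its modulus. *)
Definition npow s n : R := expR (- (s * ln n%:R)).
Definition dcos s t n : R := npow s n * cos (t * ln n%:R).
Definition dsin s t n : R := npow s n * sin (t * ln n%:R).

Lemma npow_gt0 s n : 0 < npow s n. Proof. exact: expR_gt0. Qed.

Lemma npow_ge0 s n : 0 <= npow s n. Proof. exact: expR_ge0. Qed.

Lemma npow_1 s : npow s 1 = 1.
Proof. by rewrite /npow ln1 mulr0 oppr0 expR0. Qed.

Lemma npowD s t n : npow (s + t) n = npow s n * npow t n.
Proof. by rewrite /npow mulrDl opprD expRD. Qed.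

Lemma npow_sqr s n : npow s n ^+ 2 = npow (2 * s) n.
Proof. by rewrite expr2 -npowD mulr_natl mulr2n. Qed.

Lemma lnM_nat m n : (0 < m)%N -> (0 < n)%N ->
  ln (m * n)%:R = ln m%:R + ln n%:R :> R.
Proof. by move=> m0 n0; rewrite natrM lnM// posrE ltr0n. Qed.

Lemma ln_nat_ge0 n : 0 <= ln n%:R :> R.
Proof.
case: n => [|n]; first by rewrite ln0.
by apply: ln_ge0; rewrite ler1n.
Qed.

Lemma npowM s m n : (0 < m)%N -> (0 < n)%N -> npow s (m * n)%N = npow s m * npow s n.
Proof. by move=> m0 n0; rewrite /npow lnM_nat// mulrDr opprD expRD. Qed.

Lemma npow1 n : (0 < n)%N -> npow 1 n = n%:R^-1.
Proof. by move=> n0; rewrite /npow mul1r expRN lnK// posrE ltr0n. Qed.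

Lemma npow_anti s m n : 0 <= s -> (0 < m)%N -> (m <= n)%N -> npow s n <= npow s m.
Proof.
move=> s0 m0 mn; rewrite ler_expR lerN2 ler_wpM2l//.
by rewrite ler_ln ?posrE ?ltr0n ?ler_nat// (leq_trans m0).
Qed.

Lemma npow_le s t n : s <= t -> npow t n <= npow s n.
Proof. by move=> st; rewrite ler_expR lerN2 ler_wpM2r// ln_nat_ge0. Qed.

Lemma npow_le1 s n : 0 <= s -> npow s n <= 1.
Proof. by move=> s0; rewrite -expR0 ler_expR oppr_le0 mulr_ge0// ln_nat_ge0. Qed.

Lemma dcos_1 s t : dcos s t 1 = 1.
Proof. by rewrite /dcos npow_1 ln1 mulr0 cos0 mulr1. Qed.

Lemma dsin_1 s t : dsin s t 1 = 0.
Proof. by rewrite /dsin npow_1 ln1 mulr0 sin0 mulr0. Qed.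

Lemma dcosM s t m n : (0 < m)%N -> (0 < n)%N ->
  dcos s t (m * n)%N = dcos s t m * dcos s t n - dsin s t m * dsin s t n.
Proof.
by move=> m0 n0; rewrite /dcos /dsin npowM// lnM_nat// mulrDr cosD; ring.
Qed.

Lemma dsinM s t m n : (0 < m)%N -> (0 < n)%N ->
  dsin s t (m * n)%N = dcos s t m * dsin s t n + dsin s t m * dcos s t n.
Proof.
by move=> m0 n0; rewrite /dcos /dsin npowM// lnM_nat// mulrDr sinD; ring.
Qed.

Lemma dcos2Ddsin2 s t n : dcos s t n ^+ 2 + dsin s t n ^+ 2 = npow (2 * s) n.
Proof. by rewrite !exprMn -mulrDr cos2Dsin2 mulr1 npow_sqr. Qed.

Lemma norm_dcos s t n : `|dcos s t n| <= npow s n.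
Proof. by rewrite normrM (gtr0_norm (npow_gt0 _ _)) ler_piMr ?npow_ge0// cos_max. Qed.

Lemma norm_dsin s t n : `|dsin s t n| <= npow s n.
Proof. by rewrite normrM (gtr0_norm (npow_gt0 _ _)) ler_piMr ?npow_ge0// sin_max. Qed.

Lemma lnS_sub_le n : (0 < n)%N -> ln n.+1%:R - ln n%:R <= n%:R^-1 :> R.
Proof.
move=> n0; have n0' : (0 : R) < n%:R by rewrite ltr0n.
have -> : n.+1%:R = n%:R * (1 + n%:R^-1) :> R.
  by rewrite mulrDr mulr1 divff ?gt_eqF// -natr1.
have i0 : (0 : R) < n%:R^-1 by rewrite invr_gt0.
have p1 : 0 < 1 + n%:R^-1 :> R by lra.
rewrite lnM ?posrE// addrC addKr; apply: le_ln1Dx.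
by rewrite (lt_trans _ i0)// oppr_lt0.
Qed.

Lemma lnS_sub_ge n : (0 < n)%N -> n.+1%:R^-1 <= ln n.+1%:R - ln n%:R :> R.
Proof.
move=> n0; have n0' : (0 : R) < n%:R by rewrite ltr0n.
have n1' : (0 : R) < n.+1%:R by rewrite ltr0n.
have i1 : n.+1%:R^-1 < 1 :> R by rewrite invf_lt1// ltr1n.
have e : n%:R = n.+1%:R * (1 - n.+1%:R^-1) :> R.
  by rewrite mulrBr mulr1 divff ?gt_eqF// -natr1 addrK.
have p1 : 0 < 1 - n.+1%:R^-1 :> R by rewrite subr_gt0.
rewrite [in ln n%:R]e lnM ?posrE// opprD addNKr lerNr.
by apply: le_ln1Dx; rewrite ltrN2.
Qed.

(** Together with [npowS_ge], the discrete substitute for [n^(-s) - (n+1)^(-s) = \int_n^(n+1) s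
    x^(-s-1) dx]. Both follow from [expR y >= 1 + y] and the bounds on [ln (n+1) - ln n]. *)
Lemma npowS_le s n : 0 <= s -> (0 < n)%N ->
  npow s n - npow s n.+1 <= s * npow (s + 1) n.
Proof.
move=> s0 n0; have n0' : (0 : R) < n%:R by rewrite ltr0n.
have -> : npow s n.+1 = npow s n * expR (- (s * (ln n.+1%:R - ln n%:R))).
  by rewrite /npow -expRD; congr expR; ring.
have := expR_ge1Dx (- (s * (ln n.+1%:R - ln n%:R))).
have := ler_wpM2l s0 (lnS_sub_le n0).
rewrite npowD npow1//; set e := expR _; have := npow_gt0 s n; set z := npow s n.
move=> z0 h1 h2; rewrite -[X in X - _]mulr1 -mulrBr mulrCA ler_wpM2l ?(ltW z0)//.
rewrite lerBlDr -lerBlDl; apply: le_trans h2; by rewrite lerD2l lerN2.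
Qed.

Lemma npowS_ge s n : 0 <= s -> (0 < n)%N ->
  s * npow (s + 1) n.+1 <= npow s n - npow s n.+1.
Proof.
move=> s0 n0; have n0' : (0 : R) < n%:R by rewrite ltr0n.
have -> : npow s n = npow s n.+1 * expR (s * (ln n.+1%:R - ln n%:R)).
  by rewrite /npow -expRD; congr expR; ring.
have := expR_ge1Dx (s * (ln n.+1%:R - ln n%:R)).
have := ler_wpM2l s0 (lnS_sub_ge n0).
rewrite npowD npow1//; set e := expR _; have := npow_gt0 s n.+1; set z := npow s n.+1.
move=> z0 h1 h2; rewrite -[X in _ - X]mulr1 -mulrBr mulrCA ler_wpM2l ?(ltW z0)//.
rewrite lerBrDl; apply: le_trans h2; by rewrite lerD2l.
Qed.

(** The phase [x] lets one computation serve both [dcos] ([x = 0]) and [dsin] ([x = - (pi / 2)]). *)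
Lemma is_derive_damped_cos s t x y :
  is_derive y 1 (fun y => expR (- (s * y)) * cos (t * y + x))
   (- (s * (expR (- (s * y)) * cos (t * y + x)))
    - t * (expR (- (s * y)) * sin (t * y + x))).
Proof.
have h1 : is_derive y (1:R) (fun y => - (s * y)) (- s).
  by apply: is_derive_eq; rewrite /GRing.scale /= mulr1.
have h2 : is_derive y (1:R) (fun y => t * y + x) t.
  by apply: is_derive_eq; rewrite /GRing.scale /= mulr1 addr0.
have h3 := @is_derive1_comp R expR (fun y => - (s * y)) y _ _ (is_derive_expR _) h1.
have h4 := @is_derive1_comp R cos (fun y => t * y + x) y _ _ (is_derive_cos _) h2.
apply: (is_derive_eq (is_deriveM h3 h4)); rewrite /GRing.scale /=; ring.
Qed.

Lemma damped_cos_lip s t x y0 y1 : 0 <= s -> y0 <= y1 ->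
  `|expR (- (s * y0)) * cos (t * y0 + x) - expR (- (s * y1)) * cos (t * y1 + x)| <=
  (s + `|t|) * expR (- (s * y0)) * (y1 - y0).
Proof.
move=> s0 y01; rewrite distrC.
have [|y /itvP yi ->] := @MVT_segment R _ _ y0 y1 y01
    (fun y _ => is_derive_damped_cos s t x y).
  apply: derivable_within_continuous => y _.
  by have [] := is_derive_damped_cos s t x y.
rewrite normrM (ger0_norm (_ : 0 <= y1 - y0)) ?subr_ge0// ler_wpM2r ?subr_ge0//.
apply: le_trans (ler_normB _ _) _; rewrite normrN mulrDl !normrM (ger0_norm s0).
rewrite (ger0_norm (expR_ge0 _)).
have e : expR (- (s * y)) <= expR (- (s * y0)) by rewrite ler_expR lerN2 ler_wpM2l ?yi.
have e0 := expR_ge0 (- (s * y)).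
have h c : `|c| <= 1 -> expR (- (s * y)) * `|c| <= expR (- (s * y0)).
  by move=> c1; apply: le_trans e; rewrite ler_piMr.
by apply: lerD; rewrite ler_wpM2l ?h ?cos_max ?sin_max.
Qed.

Lemma dcosS_lip s t n : 0 <= s -> (0 < n)%N ->
  `|dcos s t n - dcos s t n.+1| <= (s + `|t|) * npow (s + 1) n.
Proof.
move=> s0 n0; have ll : ln n%:R <= ln n.+1%:R :> R.
  by rewrite ler_ln ?posrE ?ltr0n ?ler_nat.
have := damped_cos_lip t 0 s0 ll; rewrite !addr0 => /le_trans; apply.
rewrite npowD npow1// mulrA ler_wpM2l ?lnS_sub_le// mulr_ge0 ?npow_ge0//.
by rewrite addr_ge0.
Qed.

Lemma dsinS_lip s t n : 0 <= s -> (0 < n)%N ->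
  `|dsin s t n - dsin s t n.+1| <= (s + `|t|) * npow (s + 1) n.
Proof.
move=> s0 n0; have ll : ln n%:R <= ln n.+1%:R :> R.
  by rewrite ler_ln ?posrE ?ltr0n ?ler_nat.
have sE z : cos (z - pi / 2) = sin z :> R.
  by rewrite cosB cos_pihalf sin_pihalf mulr0 add0r mulr1.
have := damped_cos_lip t (- (pi / 2)) s0 ll; rewrite !sE => /le_trans; apply.
rewrite npowD npow1// mulrA ler_wpM2l ?lnS_sub_le// mulr_ge0 ?npow_ge0//.
by rewrite addr_ge0.
Qed.

(** By [npowS_ge], [a] times the sum is dominated by a telescoping sum. *)
Lemma npow_tail a X Y : 0 < a -> (0 < X)%N ->
  \sum_(X.+1 <= n < Y) npow (a + 1) n <= npow a X / a.
Proof.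
move=> a0 X0; have [YX|XY] := leqP Y X.+1.
  by rewrite big_geq// divr_ge0 ?npow_ge0// ltW.
rewrite ler_pdivlMr// mulrC mulr_sumr -(subnKC (ltnW XY)).
suff h k : \sum_(X.+1 <= n < X.+1 + k) a * npow (a + 1) n <=
    npow a X - npow a (X + k)%N.
  by apply: le_trans (h _) _; rewrite lerBlDr lerDl npow_ge0.
elim: k => [|k IH]; first by rewrite !addn0 big_geq// subrr.
rewrite addnS big_nat_recr ?leq_addr//= addnS.
have := npowS_ge (ltW a0) (ltn_addr k X0).
by move: IH; rewrite addSn; lra.
Qed.

Lemma npow_small a (e : R) : 0 < a -> 0 < e ->
  exists2 X0, (0 < X0)%N & forall X, (X0 <= X)%N -> npow a X <= e.
Proof.
move=> a0 e0; have := archi_boundP (expR_ge0 (- (ln e / a))).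
set B := Num.bound _ => hB; exists B.+1 => // X BX.
rewrite -[leRHS]lnK ?posrE// ler_expR lerNl -ler_pdivrMl//.
rewrite -[leLHS]expRK ler_ln ?posrE ?expR_gt0 ?ltr0n ?(leq_trans _ BX)//.
rewrite mulrN mulrC; apply: (le_trans (ltW hB)); rewrite ler_nat.
exact: leq_trans BX.
Qed.

(** The bound is [1 + 2]: the term at [n = 1], and the tail bound [npow (1 / 2) 1 / (1 / 2)]. *)
Lemma sum_npow_3half (s' : seq nat) : uniq s' -> (forall n, n \in s' -> (0 < n)%N) ->
  \sum_(n <- s') npow (3 / 2) n <= 3.
Proof.
move=> us s0; pose Y := (\max_(n <- s') n).+1.
apply: (@le_trans _ _ (\sum_(1 <= n < Y.+1) npow (3 / 2) n)).
  apply: ler_sum_uniq_sub => //; [exact: iota_uniq| |by move=> n; exact: npow_ge0].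
  move=> n ns; rewrite mem_index_iota s0//= !ltnS ltnW// /Y ltnS.
  by rewrite (big_rem n)//= leq_maxl.
rewrite big_ltn// npow_1.
have := @npow_tail (1 / 2) 1 Y.+1 _ isT; rewrite npow_1.
have -> : 1 / 2 + 1 = 3 / 2 :> R by lra.
by move=> /(_ ltac:(lra)); set S := \sum_(_ <= _ < _) _; lra.
Qed.

End DirichletWeights.

(** * Random signed sums *)

Section SignSums.
Variable R : realType.
Implicit Types (l : seq nat) (b : nat -> bool) (u : nat -> R).

Definition sign_sum l u b : R := \sum_(p <- l) eps R b p * u p.

Lemma sign_sum_update p v l u b : p \notin l ->
  sign_sum l u (update b p v) = sign_sum l u b.
Proof.
move=> pl; apply: eq_big_seq => q ql; rewrite /eps /update.
by case: eqVneq => // qp; rewrite -qp ql in pl.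
Qed.

Lemma sign_sum_cons p l u b : sign_sum (p :: l) u b = eps R b p * u p + sign_sum l u b.
Proof. by rewrite /sign_sum big_cons. Qed.

Lemma avg_sign_sum l u b : uniq l -> avg l (sign_sum l u) b = 0.
Proof.
elim: l b => [|p l IH] b /=; first by rewrite /sign_sum big_nil.
move=> /andP[pl ul]; rewrite -[RHS](IH b ul); apply: avg_eq => {}b.
rewrite /mean !sign_sum_cons !sign_sum_update// /eps /update eqxx; lra.
Qed.

Lemma avg_sign_sum2 l u b : uniq l ->
  avg l (fun b => sign_sum l u b ^+ 2) b = \sum_(p <- l) u p ^+ 2.
Proof.
elim: l b => [|p l IH] b /=; first by rewrite /sign_sum !big_nil expr0n.
move=> /andP[pl ul]; rewrite big_cons -(IH b ul) -[u p ^+ 2](avg_cst l _ b) -avgD.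
apply: avg_eq => {}b.
rewrite /mean !sign_sum_cons !sign_sum_update// /eps /update eqxx; lra.
Qed.

Lemma avg_sign_sum3 l u b : uniq l -> avg l (fun b => sign_sum l u b ^+ 3) b = 0.
Proof.
elim: l b => [|p l IH] b /=; first by rewrite /sign_sum !big_nil expr0n.
move=> /andP[pl ul].
rewrite -[RHS](addr0 0) -[X in _ = X + _](IH b ul).
rewrite -[X in _ = _ + X](mulr0 (3 * u p ^+ 2)) -(avg_sign_sum u b ul) -avg_scale -avgD.
apply: avg_eq => {}b.
rewrite /mean !sign_sum_cons !sign_sum_update// /eps /update eqxx; lra.
Qed.

(** Adding a sign of weight [w] to a sum of variance [V] adds [6 w^2 V + w^4] to the fourth moment,
    and [3 V^2 + 6 w^2 V + w^4 <= 3 (V + w^2)^2]. *)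
Lemma avg_sign_sum4 l u b : uniq l ->
  avg l (fun b => sign_sum l u b ^+ 4) b <= 3 * (\sum_(p <- l) u p ^+ 2) ^+ 2.
Proof.
elim: l b => [|p l IH] b /=; first by rewrite /sign_sum !big_nil !expr0n /= mulr0.
move=> /andP[pl ul]; rewrite big_cons.
have -> : avg l (mean p (fun b => sign_sum (p :: l) u b ^+ 4)) b =
   avg l (fun b => sign_sum l u b ^+ 4) b +
   (6 * u p ^+ 2 * avg l (fun b => sign_sum l u b ^+ 2) b + u p ^+ 4).
  rewrite -avg_scale -[u p ^+ 4](avg_cst l _ b) -!avgD.
  apply: avg_eq => {}b.
  rewrite /mean !sign_sum_cons !sign_sum_update// /eps /update eqxx; lra.
rewrite avg_sign_sum2//; have := IH b ul; set V := \sum_(_ <- _) _.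
have := sqr_ge0 (u p ^+ 2); set z := avg l _ b; set w := u p.
have -> : w ^+ 4 = (w ^+ 2) ^+ 2 by rewrite -exprM.
by set y := w ^+ 2; nra.
Qed.

(* The quartic below is at most $32 v^4$ everywhere, nonpositive for
   $S < v/12$, and has mean at least $v^4/2$ by the first four moments. *)
Lemma prob_sign_sum_ge l u b (v : R) : uniq l -> 0 < v ->
  v ^+ 2 = \sum_(p <- l) u p ^+ 2 ->
  1 / 64 <= prob R l (fun b => v / 12 <= sign_sum l u b) b.
Proof.
move=> ul v0 vV.
pose q (S : R) := (S - v / 12) * (2 * v - S) * (S + 2 * v) ^+ 2.
have qE S : q S = (- (2/3) * v ^+ 4) + ((8 - 4/12) * v ^+ 3 * S + (
   (4 + 2/12) * v ^+ 2 * S ^+ 2 + ((-2 + 1/12) * v * S ^+ 3 + (-1) * S ^+ 4))).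
  by rewrite /q; field.
have qavg : v ^+ 4 / 2 <= avg l (fun b => q (sign_sum l u b)) b.
  rewrite (avg_eq _ (fun b => qE (sign_sum l u b))) !avgD !avg_scale avg_cst.
  rewrite avg_sign_sum// avg_sign_sum2// avg_sign_sum3// -vV.
  have := avg_sign_sum4 u b ul; rewrite -vV; set z := avg _ _ _ => z3; move: z3.
  have -> : (v ^+ 2) ^+ 2 = v ^+ 4 by rewrite -exprM.
  have -> : (4 + 2/12) * v ^+ 2 * v ^+ 2 = (4 + 2/12) * v ^+ 4 by ring.
  have y0 : 0 < v ^+ 4 by rewrite exprn_gt0.
  move=> z4; rewrite (_ : v * (v * (v * v)) = v ^+ 4)//.
  by set y := v ^+ 4 in y0 z4 *; lra.
have qle S : q S <= 32 * v ^+ 4 * ((v / 12 <= S)%R : bool)%:R.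
  have [Sv|Sv] := leP (v / 12) S; rewrite /= ?mulr1 ?mulr0.
    have [S2|S2] := leP S (2 * v); last first.
      apply: (@le_trans _ _ 0); last by rewrite mulr_ge0// exprn_ge0// ltW.
      by apply: mulr_le0_ge0; [apply: mulr_ge0_le0; lra | exact: sqr_ge0].
    have h1 : (S - v / 12) * (S + 2 * v) <= 8 * v ^+ 2 by nra.
    have h2 : (2 * v - S) * (S + 2 * v) <= 4 * v ^+ 2 by nra.
    have -> : 32 * v ^+ 4 = (8 * v ^+ 2) * (4 * v ^+ 2) by ring.
    have -> : q S = ((S - v / 12) * (S + 2 * v)) * ((2 * v - S) * (S + 2 * v)).
      by rewrite /q; ring.
    by apply: ler_pM => //; apply: mulr_ge0; lra.
  rewrite /q; have [S2|S2] := leP S (2 * v).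
    by apply: mulr_le0_ge0; [apply: mulr_le0_ge0; lra | exact: sqr_ge0].
  by exfalso; lra.
have v4 : 0 < v ^+ 4 by rewrite exprn_gt0.
rewrite /prob -(ler_pM2l (_ : 0 < 32 * v ^+ 4)); last by lra.
by rewrite -avg_scale; apply: le_trans (le_trans qavg (avg_le _ _ (fun b => qle _))); lra.
Qed.

(** The function [g y = ln (1 + y) - y + y^2 / 2] vanishes at 0 and has derivative [y^2 / (1 + y)].
    This is nonnegative for [y >= 0]; between a negative [x] and 0 it is at most [16 x^2], since
    [1 + y >= 1/16] there. *)
Lemma ln1D_ge (x : R) : - (15 / 16) <= x ->
  x - x ^+ 2 / 2 - 16 * `|x| ^+ 3 <= ln (1 + x).
Proof.
move=> x1; pose g (y : R) := ln (1 + y) - y + y ^+ 2 / 2.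
have dg (y : R) : -1 < y -> is_derive y 1 g (y ^+ 2 / (1 + y)).
  move=> y1; have y1' : 0 < 1 + y by lra.
  have h1 : is_derive y (1:R) (fun y : R => 1 + y) 1.
    by have := is_deriveD (is_derive_cst (1:R) y (1:R)) (is_derive_id y (1:R)); rewrite add0r.
  have h2 := @is_derive1_comp R (@ln R) (fun y => 1 + y) y _ _ (is_derive1_ln y1') h1.
  have h3 : is_derive y (1:R) (fun y : R => y ^+ 2 / 2) y.
    by apply: is_derive_eq; rewrite /GRing.scale /=; field.
  have h4 := is_deriveD (is_deriveB h2 (is_derive_id y (1:R))) h3.
  by apply: (is_derive_eq h4); field; rewrite gt_eqF.
have g0 : g 0 = 0 by rewrite /g addr0 ln1; ring.
have cg (a b : R) : -1 < a -> {within `[a, b], continuous g}.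
  move=> a1; apply: derivable_within_continuous => y /itvP yi.
  have y1 : -1 < y by apply: (lt_le_trans a1); rewrite yi.
  by have [] := dg y y1.
have [x0|x0] := leP 0 x.
  have [y /itvP yi||y /itvP yi] :=
      @MVT_segment R g (fun y => y ^+ 2 / (1 + y)) 0 x x0.
  - by apply: dg; rewrite (lt_le_trans _ (_ : 0 <= y)) ?yi.
  - by apply: cg; lra.
  have y0 : 0 <= y by rewrite yi.
  rewrite g0 !subr0 => gx; have : 0 <= g x.
    by rewrite gx mulr_ge0// divr_ge0 ?sqr_ge0//; lra.
  have := exprn_ge0 3 (normr_ge0 x); rewrite /g.
  by set z := _ ^+ 3; set w := x ^+ 2; set L := ln _; lra.
have x2 : -1 < x by lra.
have [y /itvP yi||y /itvP yi] :=
    @MVT_segment R g (fun y => y ^+ 2 / (1 + y)) x 0 (ltW x0).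
- by apply: dg; rewrite (lt_trans x2)// yi.
- exact: cg.
have xy : x <= y by rewrite yi.
have y0 : y <= 0 by rewrite yi.
rewrite g0 !sub0r => gx.
have : y ^+ 2 / (1 + y) <= 16 * x ^+ 2.
  by rewrite ler_pdivrMr; [nra|lra].
have nx : 0 <= - x by lra.
move=> /(ler_wpM2r nx).
rewrite -gx ltr0_norm// /g.
have -> : 16 * x ^+ 2 * - x = 16 * (- x) ^+ 3 by ring.
by set z := _ ^+ 3; set w := x ^+ 2; set L := ln _; lra.
Qed.

(** With [z = u + i v] of modulus [r], this expands [ln |1 + e z|^2 = ln (1 + x)], where
    [x = 2 e u + r^2]. The term [- x^2 / 2] contributes [- 2 u^2], which turns [r^2] into
    [v^2 - u^2]. The constant [435] exceeds [16 * 27 + 5 / 2], which comes from [|x| <= 3 r] and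
    [x^2 <= 4 u^2 + 5 r^3]; [1/16] is [(1 - r)^2] at [r = 3/4]. *)
Lemma ln_euler_factor_ge (e u v r : R) : e ^+ 2 = 1 -> 0 <= r -> r <= 3 / 4 ->
  u ^+ 2 + v ^+ 2 = r ^+ 2 ->
  1 / 16 <= (1 + e * u) ^+ 2 + v ^+ 2 /\
  2 * (e * u) - (u ^+ 2 - v ^+ 2) - 435 * r ^+ 3 <=
    ln ((1 + e * u) ^+ 2 + v ^+ 2).
Proof.
move=> e2 r0 r1 uvr; pose w := e * u.
have w2 : w ^+ 2 = u ^+ 2 by rewrite exprMn e2 mul1r.
have wr : `|w| <= r.
  by rewrite -ler_sqr ?nnegrE// real_normK ?num_real// w2 -uvr lerDl sqr_ge0.
have /andP[wr1 wr2] : - r <= w <= r by rewrite -ler_norml.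
pose x := 2 * w + r ^+ 2.
have -> : (1 + e * u) ^+ 2 + v ^+ 2 = 1 + x by rewrite /x -uvr -w2 -/w; ring.
have x1 : - (15 / 16) <= x by rewrite /x; nra.
split; first by lra.
apply: le_trans (ln1D_ge x1).
have x3 : `|x| <= 3 * r by rewrite ler_norml /x; apply/andP; split; nra.
have : `|x| ^+ 3 <= (3 * r) ^+ 3 by apply: lerXn2r; rewrite ?nnegrE//; lra.
set z := `|x| ^+ 3; have -> : (3 * r) ^+ 3 = 27 * r ^+ 3 by ring.
move=> zr.
have h : x ^+ 2 <= 4 * u ^+ 2 + 5 * r ^+ 3.
  have -> : x ^+ 2 = 4 * u ^+ 2 + 4 * (w * r ^+ 2) + r * r ^+ 3.
    by rewrite /x -w2; ring.
  have : w * r ^+ 2 <= r * r ^+ 2 by rewrite ler_wpM2r ?sqr_ge0.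
  have -> : r * r ^+ 2 = r ^+ 3 by ring.
  have : r * r ^+ 3 <= 1 * r ^+ 3 by rewrite ler_wpM2r ?exprn_ge0//; lra.
  by set a := r ^+ 3; set c := r * a; set d := w * _; set f := u ^+ 2; lra.
have xE : x = 2 * (e * u) + (u ^+ 2 + v ^+ 2) by rewrite uvr.
have r3 : 0 <= r ^+ 3 by rewrite exprn_ge0.
clearbody x z; move: zr h xE r3.
move: (r ^+ 3) (u ^+ 2) (v ^+ 2) (e * u) (x ^+ 2) => a c d f y; lra.
Qed.

End SignSums.

(** * A block of the Euler product is large with positive probability *)

Section Block.
Variable R : realType.
Implicit Types (l : seq nat) (b : nat -> bool) (s t : R).

Lemma is_derive_sum_seq (I : eqType) (l : seq I) (F dF : I -> R -> R) (t : R) :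
  (forall i, i \in l -> is_derive t 1 (F i) (dF i t)) ->
  is_derive t 1 (fun x => \sum_(i <- l) F i x) (\sum_(i <- l) dF i t).
Proof.
elim: l => [|i l IH] h.
  rewrite big_nil (_ : (fun _ => _) = cst 0); first exact: is_derive_cst.
  by apply/funext => x; rewrite big_nil.
rewrite big_cons (_ : (fun _ => _) = F i + (fun x => \sum_(i <- l) F i x)); last first.
  by apply/funext => x; rewrite big_cons.
apply: is_deriveD; first by apply: h; rewrite mem_head.
by apply: IH => j jl; apply: h; rewrite inE jl orbT.
Qed.

Lemma ln_prime_ge p : prime p -> 1 / 2 <= ln p%:R :> R.
Proof.
move=> pp; have := @lnS_sub_ge R 1 isT; rewrite ln1 subr0 => h.
apply: (@le_trans _ _ (ln 2)); first by rewrite div1r.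
by rewrite ler_ln ?posrE ?ltr0n ?prime_gt0// ler_nat prime_gt1.
Qed.

(* By the mean value theorem, the average of the cosine sum over [0, L] is
   small at some point. *)
Lemma exists_small_cos_sum l (c : nat -> R) (L : R) :
  all_prime l -> (forall p, 0 <= c p) -> L = \sum_(p <- l) c p -> 0 < L ->
  exists t, [/\ 0 <= t, t <= L & `|\sum_(p <- l) c p * cos (2 * (t * ln p%:R))| <= 1].
Proof.
move=> lP c0 LE L0.
(* Antiderivatives vanishing at 0. Since [2 ln p >= 1], each is at most [c p] in modulus, so their
   sum at [L] is at most [L] and the mean of the derivative is at most 1. *)
pose F (p : nat) (t : R) := c p / (2 * ln p%:R) * sin (2 * ln p%:R * t).
have lp p : p \in l -> (0 : R) < 2 * ln p%:R.
  by move=> /lP /ln_prime_ge h; set z := ln _ in h *; lra.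
have dF t p : p \in l -> is_derive t 1 (F p) (c p * cos (2 * (t * ln p%:R))).
  move=> /lp pl; set m := 2 * ln p%:R in pl.
  have h1 : is_derive t (1:R) (fun t => m * t) m.
    by apply: is_derive_eq; rewrite /GRing.scale /= mulr1.
  have h2 := @is_derive1_comp R sin (fun t => m * t) t _ _ (is_derive_sin _) h1.
  have h3 := is_deriveZ (c p / m) h2.
  apply: (is_derive_eq h3); rewrite /GRing.scale /=.
  have -> : 2 * (t * ln p%:R) = m * t by rewrite /m; ring.
  by field; rewrite gt_eqF.
have dS t : is_derive t 1 (fun t => \sum_(p <- l) F p t)
    (\sum_(p <- l) c p * cos (2 * (t * ln p%:R))).
  exact: (@is_derive_sum_seq _ l F (fun p t => c p * cos (2 * (t * ln p%:R)))).
have [|t /itvP ti] := @MVT_segment R _ _ 0 L (ltW L0) (fun t _ => dS t).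
  by apply: derivable_within_continuous => y _; have [] := dS y.
rewrite [X in _ - X](_ : _ = 0) ?subr0 => [e|]; last first.
  by rewrite big1// => p _; rewrite /F mulr0 sin0 mulr0.
exists t; split; rewrite ?ti//.
rewrite -(ler_pM2r L0) mul1r -[X in _ * X](gtr0_norm L0) -normrM -e.
apply: le_trans (ler_norm_sum _ _ _) _; rewrite LE big_seq [leRHS]big_seq.
apply: ler_sum => p pl; rewrite normrM.
apply: (@le_trans _ _ `|c p / (2 * ln p%:R)|); first by rewrite ler_piMr ?sin_max.
rewrite ger0_norm; last by rewrite divr_ge0// ltW// lp.
rewrite ler_pdivrMr ?lp//; apply: ler_peMr => //.
by have := ln_prime_ge (lP _ pl); set z := ln _; lra.
Qed.

(** Squared modulus at [s + i t] of the Euler product over the primes of [l]. *)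
Definition euler_sqr l s t b : R :=
  \prod_(p <- l) ((1 + eps R b p * dcos s t p) ^+ 2 + dsin s t p ^+ 2).

Lemma npow_prime_le s p : 1 / 2 <= s -> prime p -> npow s p <= 3 / 4 :> R.
Proof.
move=> s1 pp; apply: (@le_trans _ _ (npow (1 / 2) 2)).
  apply: (@le_trans _ _ (npow s 2)); last exact: npow_le.
  by apply: npow_anti; rewrite ?prime_gt1//; lra.
have := npow_sqr (1 / 2 : R) 2.
have -> : 2 * (1 / 2) = 1 :> R by lra.
rewrite npow1//; have := npow_ge0 (1 / 2 : R) 2; set z := npow _ _; nra.
Qed.

Lemma euler_factor_ge s t p b : 1 / 2 <= s -> prime p ->
  1 / 16 <= (1 + eps R b p * dcos s t p) ^+ 2 + dsin s t p ^+ 2 /\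
  2 * (eps R b p * dcos s t p) - npow (2 * s) p * cos (2 * (t * ln p%:R)) -
     435 * npow (3 / 2) p <=
   ln ((1 + eps R b p * dcos s t p) ^+ 2 + dsin s t p ^+ 2).
Proof.
move=> s1 pp.
have e : dcos s t p ^+ 2 + dsin s t p ^+ 2 = npow s p ^+ 2.
  by rewrite dcos2Ddsin2 npow_sqr.
have [h1 h2] := ln_euler_factor_ge (eps_sqr R b p) (npow_ge0 s p) (npow_prime_le s1 pp) e.
split=> //; apply: le_trans h2.
have -> : npow (2 * s) p * cos (2 * (t * ln p%:R)) = dcos s t p ^+ 2 - dsin s t p ^+ 2.
  have -> : 2 * (t * ln p%:R) = t * ln p%:R + t * ln p%:R :> R by ring.
  by rewrite cosD !exprMn npow_sqr -!expr2 -mulrBr.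
rewrite lerD2l lerN2; apply: ler_wpM2l; first exact: ler0n.
have -> : npow s p ^+ 3 = npow (3 * s) p.
  have s3 : s + 2 * s = 3 * s by ring.
  by rewrite exprS npow_sqr -npowD s3.
by apply: npow_le; lra.
Qed.

(** Crude, but valid for every choice of signs; it serves for the primes that earlier blocks have
    used up. *)
Lemma euler_sqr_ge l s t b : all_prime l -> 1 / 2 <= s ->
  (1 / 16) ^+ size l <= euler_sqr l s t b.
Proof.
move=> lP s1; rewrite /euler_sqr; elim: l lP => [|p l IH]; first by rewrite big_nil.
move=> /all_prime_cons[pp lP]; rewrite big_cons /= [leLHS]exprS.
have [h _] := euler_factor_ge t b s1 pp.
by apply: ler_pM; [lra | apply: exprn_ge0; lra | exact: h | exact: IH].
Qed.

(* [1305] is [435] times the bound [3] for the sum of the [n^(-3/2)]. *)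
Lemma ln_euler_sqr_ge l s t b : all_prime l -> uniq l -> 1 / 2 <= s ->
  2 * sign_sum l (dcos s t) b -
    \sum_(p <- l) npow (2 * s) p * cos (2 * (t * ln p%:R)) - 1305 <=
  ln (euler_sqr l s t b).
Proof.
move=> lP ul s1.
apply: (@le_trans _ _ (\sum_(p <- l) ln ((1 + eps R b p * dcos s t p) ^+ 2 + dsin s t p ^+ 2))).
  have h : \sum_(p <- l) npow (3 / 2) p <= 3 :> R.
    by apply: sum_npow_3half => // p /lP /prime_gt0.
  apply: (@le_trans _ _ (2 * sign_sum l (dcos s t) b -
    \sum_(p <- l) npow (2 * s) p * cos (2 * (t * ln p%:R)) -
      435 * \sum_(p <- l) npow (3 / 2) p)); first by lra.
  rewrite /sign_sum !mulr_sumr -!sumrB big_seq [leRHS]big_seq.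
  by apply: ler_sum => p /lP pp; have [] := euler_factor_ge t b s1 pp.
rewrite /euler_sqr; elim: l lP {ul} => [|p l IH]; first by rewrite !big_nil ln1.
move=> /all_prime_cons[pp lP]; rewrite !big_cons lnM ?posrE ?lerD2l ?IH//.
  by have [] := euler_factor_ge t b s1 pp; lra.
by apply: lt_le_trans (euler_sqr_ge t b lP s1); apply: exprn_gt0; lra.
Qed.

(** The point [t] is chosen before the signs, by [exists_small_cos_sum], so that the second-order
    sum is at most 1 in modulus. By the double-angle formula the variance [V] then satisfies
    [2 V >= L - 1]. Doubling the threshold [sqrt V / 12] gives the [/ 6], and [1306 = 1305 + 1]. *)
Lemma prob_euler_sqr_ge l s (L : R) : all_prime l -> uniq l -> 1 / 2 <= s ->
  L = \sum_(p <- l) npow (2 * s) p -> 2 <= L ->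
  exists t, [/\ 0 <= t, t <= L & forall b, 1 / 64 <=
    prob R l (fun b => expR (Num.sqrt ((L - 1) / 2) / 6 - 1306) <= euler_sqr l s t b) b].
Proof.
move=> lP ul s1 LE L2.
have [|t [t0 tL tc]] := exists_small_cos_sum lP (npow_ge0 (2 * s)) LE; first by lra.
exists t; split=> // b; set c := \sum_(_ <- _) _ in tc.
set V := \sum_(p <- l) dcos s t p ^+ 2.
have VE : 2 * V = L + c.
  rewrite LE /V /c mulr_sumr -big_split /=; apply: eq_bigr => p _.
  have -> : 2 * (t * ln p%:R) = t * ln p%:R + t * ln p%:R :> R by ring.
  rewrite cosD -npow_sqr /dcos; have := cos2Dsin2 (t * ln p%:R).
  move: (cos _) (sin _) (npow _ _) => x y z; nra.
move: tc; rewrite ler_norml => /andP[c1 c2].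
have VL : (L - 1) / 2 <= V by lra.
have V0 : 0 < V by lra.
have vV : Num.sqrt V ^+ 2 = V by rewrite sqr_sqrtr// ltW.
have v0 : 0 < Num.sqrt V by rewrite sqrtr_gt0.
apply: le_trans (prob_sign_sum_ge b ul v0 vV) _; apply: prob_le => {}b hb.
have := ln_euler_sqr_ge t b lP ul s1; rewrite -/c => h.
have e0 : 0 < euler_sqr l s t b.
  by apply: lt_le_trans (euler_sqr_ge t b lP s1); apply: exprn_gt0; lra.
rewrite -[leRHS]lnK ?posrE// ler_expR; apply: le_trans h.
have : Num.sqrt ((L - 1) / 2) <= Num.sqrt V by rewrite ler_wsqrtr.
by lra.
Qed.

End Block.

(** * Truncation errors *)

Section Unbounded.
Variable R : realType.
Implicit Types (l : seq nat) (b : nat -> bool) (s t C : R).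

Lemma abel_summation (a u : nat -> R) X :
  \sum_(1 <= n < X.+1) u n * a n =
  \sum_(1 <= n < X.+1) (\sum_(1 <= k < n.+1) a k) * (u n - u n.+1) +
  (\sum_(1 <= k < X.+1) a k) * u X.+1.
Proof.
elim: X => [|X IH]; first by rewrite !big_geq// mul0r addr0.
rewrite big_nat_recr//= IH [in RHS]big_nat_recr//=.
have -> : \sum_(1 <= k < X.+2) a k = \sum_(1 <= k < X.+1) a k + a X.+1.
  by rewrite big_nat_recr.
by ring.
Qed.

Definition complete_upto (N : nat) l : Prop :=
  uniq l /\ forall p, (p \in l) = prime p && (p <= N)%N.

Lemma complete_upto_prime N l : complete_upto N l -> all_prime l.
Proof. by move=> [_ lN] p; rewrite lN => /andP[]. Qed.

Lemma complete_uptoS N X l : (N <= X)%N -> complete_upto N l ->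
  complete_upto X (primes_in N X ++ l).
Proof.
move=> NX [ul lN]; split=> [|p].
  rewrite cat_uniq primes_in_uniq ul andbT; apply/hasPn => p; rewrite lN => /andP[_ pN].
  by rewrite mem_primes_in ltnNge pN andbF.
rewrite mem_cat mem_primes_in lN; case: (prime p) => //=.
by case: (ltnP N p) => [_|pN] /=; rewrite ?orbF// (leq_trans pN NX).
Qed.

Lemma complete_upto_primes_in X : complete_upto X (primes_in 0 X).
Proof.
split=> [|p]; first exact: primes_in_uniq.
by rewrite mem_primes_in; case: (boolP (prime p)) => // pp; rewrite prime_gt0.
Qed.

Lemma eps_congr b b' p : b p = b' p -> eps R b p = eps R b' p.
Proof. by rewrite /eps => ->. Qed.

Lemma supported_walsh l a : all_prime l -> supported l (@walsh R l a).
Proof.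
move=> lP b b' e; apply: eq_big_seq => n nl; congr (_ * _).
by apply: eq_big_seq => p pn; apply/eps_congr/e/(primes_sqfree_over lP nl).
Qed.

Lemma supported_psum X l : complete_upto X l ->
  supported l (fun b => psum R b X).
Proof.
move=> lX b b' e; have lP := complete_upto_prime lX; have [ul lE] := lX.
have h c : psum R c X = walsh l (fun n => if (n <= X)%N then 1 else 0) c.
  rewrite -(sum_rmf _ _ lP ul); last by move=> p pp pX; rewrite lE pp.
  by apply: eq_bigr => n _; rewrite mul1r.
by rewrite !h; apply: supported_walsh.
Qed.

Lemma supported_euler_sqr l s t : supported l (euler_sqr l s t).
Proof. by move=> b b' e; apply: eq_big_seq => p /e /eps_congr ->. Qed.

(** The Euler product over the primes up to [X] also contains numbers beyond [X] built from these
    primes; this is their contribution. *)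
Definition wtail l (u : nat -> R) X b : R :=
  walsh l (fun n => if (n <= X)%N then 0 else u n) b.

Lemma walsh_split l (u : nat -> R) X b : complete_upto X l ->
  walsh l u b = \sum_(1 <= n < X.+1) psum R b n * (u n - u n.+1) +
    psum R b X * u X.+1 + wtail l u X b.
Proof.
move=> lX; rewrite -abel_summation (sum_rmf _ _ (complete_upto_prime lX) lX.1).
  rewrite -big_split /=; apply: eq_bigr => n _; rewrite -mulrDl; congr (_ * _).
  by case: leqP; rewrite ?addr0 ?add0r.
by move=> p pp pX; rewrite lX.2 pp.
Qed.

Lemma avg_psum_sqr l X b : complete_upto X l ->
  avg l (fun b => psum R b X ^+ 2) b <= X%:R.
Proof.
move=> lX; have lP := complete_upto_prime lX.
pose a n : R := if (n <= X)%N then 1 else 0.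
have h c : psum R c X ^+ 2 = walsh l a c ^+ 2.
  rewrite -(@sum_rmf R l X (fun=> 1) c lP lX.1); last by move=> p pp pX; rewrite lX.2 pp.
  by congr (_ ^+ 2); apply: eq_bigr => n _; rewrite mul1r.
rewrite (avg_eq _ h) avg_walsh_sqr//; last exact: lX.1.
apply: (@le_trans _ _ (\sum_(n <- sqfree_over l | (n <= X)%N) 1)).
  rewrite [leRHS]big_mkcond; apply: ler_sum => n _; rewrite /a.
  by case: ifP => _; rewrite ?expr1n ?expr0n.
rewrite -big_filter; apply: (@le_trans _ _ (\sum_(n <- index_iota 1 X.+1) 1)).
  apply: ler_sum_uniq_sub => //.
  - by rewrite filter_uniq// uniq_sqfree_over// lX.1.
  - exact: iota_uniq.
  - move=> n; rewrite mem_filter mem_index_iota ltnS => /andP[-> nl].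
    by rewrite (sqfree_over_gt0 lP nl).
by rewrite big_const_seq count_predT size_iota subn1 iter_addr_0.
Qed.

(** Chebyshev's inequality: the second moment of the partial sum is at most [X], and
    [X * X^(-2s) = X^(-(2s-1))]. *)
Lemma prob_psum_large l s X b : complete_upto X l -> (0 < X)%N ->
  prob R l (fun b => ~~ (`|psum R b X| * npow s X <= 1)) b <= npow (2 * s - 1) X.
Proof.
move=> lX X0.
apply: le_trans (@markov R l _ (fun b => npow (2 * s) X * psum R b X ^+ 2) b _ _) _.
- by move=> c; rewrite mulr_ge0 ?sqr_ge0 ?npow_ge0.
- move=> c; rewrite -ltNge => /ltW h; rewrite -npow_sqr -[psum _ _ _ ^+ 2]real_normK ?num_real//.
  by rewrite -exprMn mulrC; apply: exprn_ege1.
rewrite avg_scale.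
apply: le_trans (ler_wpM2l (npow_ge0 _ _) (avg_psum_sqr b lX)) _.
by rewrite -[X in npow X _](subrK 1) npowD npow1// mulfVK// pnatr_eq0 -lt0n.
Qed.

(** By Parseval the second moment is at most the sum of [n^(-2s)] over [n > X], which is controlled
    because [2 s > 1]. *)
Lemma prob_wtail_large l (u : nat -> R) s X b : complete_upto X l -> (0 < X)%N ->
  1 / 2 < s -> (forall n, `|u n| <= npow s n) ->
  prob R l (fun b => ~~ (`|wtail l u X b| <= 1)) b <= npow (2 * s - 1) X / (2 * s - 1).
Proof.
move=> lX X0 s1 us; have lP := complete_upto_prime lX.
apply: le_trans (@markov R l _ (fun b => wtail l u X b ^+ 2) b _ _) _.
- by move=> c; exact: sqr_ge0.
- move=> c; rewrite -ltNge => /ltW h; rewrite -real_normK ?num_real//.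
  exact: exprn_ege1.
rewrite avg_walsh_sqr//; last exact: lX.1.
pose Y := (\max_(n <- sqfree_over l) n).+1.
have a0 : 0 < 2 * s - 1 by lra.
apply: le_trans (npow_tail Y a0 X0); rewrite subrK.
apply: (@le_trans _ _ (\sum_(n <- sqfree_over l | (X < n)%N) npow (2 * s) n)).
  rewrite [leRHS]big_mkcond; apply: ler_sum => n _; rewrite ltnNge; case: leqP => _ /=.
    by rewrite expr0n.
  rewrite -npow_sqr -real_normK ?num_real//; apply: lerXn2r => //.
  by rewrite nnegrE npow_ge0.
rewrite -big_filter; apply: ler_sum_uniq_sub => //.
- by rewrite filter_uniq// uniq_sqfree_over// lX.1.
- exact: iota_uniq.
- move=> n; rewrite mem_filter mem_index_iota ltnS => /andP[-> nl] /=.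
  by rewrite (big_rem n)//= leq_maxl.
- by move=> n; exact: npow_ge0.
Qed.

(** First [X] is chosen so that the reciprocals of the primes in [(N, X]] add up to at least
    [2 |K|]; then [s] so close to 1/2 that [p^(-(2s-1)) >= 1/2] for all [p <= X]. A larger [Y] only
    adds terms. *)
Lemma exists_large_weight N (K d : R) : 0 < d -> exists X s,
  [/\ (N <= X)%N, 1 / 2 < s, s <= 1, s < 1 / 2 + d &
    forall Y, (X <= Y)%N -> K <= \sum_(p <- primes_in N Y) npow (2 * s) p].
Proof.
move=> d0; have [X NX hX] := sum_inv_primes_dvg N (2 * `|K|).
pose e : R := Num.min d (1 / (2 * (1 + ln X%:R))).
have l0 := ln_nat_ge0 R X; set L := ln _ in e l0.
have i0 : 0 < 1 / (2 * (1 + L)) by rewrite divr_gt0//; lra.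
have e0 : 0 < e by rewrite /e lt_min d0 i0.
have ed : e <= d by rewrite /e ge_min lexx.
have eL : e * (2 * (1 + L)) <= 1.
  by rewrite -ler_pdivlMr ?ge_min ?lexx ?orbT//; lra.
exists X, (1 / 2 + e / 2); split=> //; try by nra.
move=> Y XY; apply: (le_trans (ler_norm K)).
have -> : 2 * (1 / 2 + e / 2) = 1 + e by field.
apply: (@le_trans _ _ (\sum_(p <- primes_in N X) npow (1 + e) p)); last first.
  apply: ler_sum_uniq_sub; rewrite ?primes_in_uniq//.
    by move=> p; rewrite !mem_primes_in => /and3P[-> -> pX]; rewrite (leq_trans pX XY).
  by move=> p; exact: npow_ge0.
have h : 1 / 2 <= npow e X.
  by rewrite /npow -/L; apply: le_trans (expR_ge1Dx _); nra.
apply: (@le_trans _ _ (\sum_(p <- primes_in N X) p%:R^-1 * (1 / 2))).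
  by rewrite -mulr_suml; lra.
rewrite big_seq [leRHS]big_seq; apply: ler_sum => p.
rewrite mem_primes_in => /and3P[/prime_gt0 p0 _ pX].
rewrite npowD npow1//; apply: ler_wpM2l; first by rewrite invr_ge0.
by apply: le_trans h _; apply: npow_anti => //; exact: ltW.
Qed.

(** In terms of [y = sqrt ((L - 1) / 2) / 6], that is [L = 72 y^2 + 1], the left side is a
    polynomial of degree at most 4, beaten by [expR y >= ((1 + y) / 5)^5]. *)
Lemma exp_sqrt_beats_sqr (a C k : R) : 0 < a -> 0 <= C -> exists2 L0 : R, 2 <= L0 &
  forall L, L0 <= L ->
    2 * ((1 + L) * C + 2) ^+ 2 < a * expR (Num.sqrt ((L - 1) / 2) / 6 - k).
Proof.
move=> a0 C0; pose K := 2 * (72 * C + 2) ^+ 2.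
have K0 : 0 < K by rewrite /K; nra.
pose a' := a * expR (- k).
have a'0 : 0 < a' by rewrite mulr_gt0 ?expR_gt0.
(* Chosen so that [K < a' * ((1 + y) / 5 ^+ 5)] as soon as [y >= Y]. *)
pose Y := K * 5 ^+ 5 / a'.
have Y0 : 0 < Y by rewrite divr_gt0// mulr_gt0// exprn_gt0.
exists (72 * (Y + 1) ^+ 2 + 1); first by nra.
move=> L LY; set y := Num.sqrt ((L - 1) / 2) / 6.
have L1 : 0 <= (L - 1) / 2 by nra.
have yE : 72 * y ^+ 2 + 1 = L.
  by rewrite /y expr_div_n sqr_sqrtr//; field.
have y0 : 0 <= y by rewrite divr_ge0// sqrtr_ge0.
have yY : Y <= y by nra.
have -> : a * expR (y - k) = a' * expR y by rewrite /a' expRD mulrA mulrAC.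
clearbody y; clear LY L1; subst L.
have h1 : 2 * ((1 + (72 * y ^+ 2 + 1)) * C + 2) ^+ 2 <= K * (1 + y) ^+ 4.
  have -> : K * (1 + y) ^+ 4 = 2 * ((72 * C + 2) * (1 + y) ^+ 2) ^+ 2 by rewrite /K; ring.
  rewrite ler_pM2l// ler_sqr ?nnegrE; nra.
have h2 : ((1 + y) / 5) ^+ 5 <= expR y.
  have -> : expR y = expR (y / 5) ^+ 5 by rewrite -expRM_natl; congr expR; field.
  by apply: lerXn2r; rewrite ?nnegrE ?expR_ge0//; have := expR_ge1Dx (y / 5); lra.
apply: le_lt_trans h1 _; rewrite mulrC; apply: lt_le_trans (ler_wpM2l (ltW a'0) h2).
have -> : ((1 + y) / 5) ^+ 5 = (1 + y) ^+ 4 * ((1 + y) / 5 ^+ 5) by field.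
rewrite [X in _ < X]mulrCA ltr_pM2l; last by rewrite exprn_gt0//; lra.
rewrite mulrA ltr_pdivlMr ?exprn_gt0// [X in _ < X]mulrC -ltr_pdivrMr// -/Y.
by lra.
Qed.

End Unbounded.

(** * The sum of |M(n)| n^(-3/2) diverges *)

Section BoundedMassIsNull.
Variable R : realType.
Implicit Types (l : seq nat) (b : nat -> bool) (s t C : R).

(** Nullity under fair coin tossing, phrased through coverings by events on finitely many signs, so
    that no measure on sign sequences has to be constructed. *)
Definition cylnull (A : (nat -> bool) -> Prop) : Prop :=
  forall e : R, 0 < e -> exists l (Q : (nat -> bool) -> bool),
    [/\ uniq l, all_prime l, supported l Q, forall b, A b -> Q b &
        forall b, prob R l Q b <= e].

Definition mass_le C b : Prop :=
  forall X, \sum_(1 <= n < X.+1) `|psum R b n| * npow (3 / 2) n <= C.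

(** The three terms of [walsh_split]: the weighted sum costs [K * C] since [n^(-s-1) <= n^(-3/2)],
    the boundary term and the tail cost 1 each. *)
Lemma norm_walsh_le l (u : nat -> R) s (K C : R) X b : complete_upto X l ->
  (0 < X)%N -> 1 / 2 <= s -> 0 <= K ->
  (forall n, (0 < n)%N -> `|u n - u n.+1| <= K * npow (s + 1) n) ->
  (forall n, `|u n| <= npow s n) -> mass_le C b ->
  `|psum R b X| * npow s X <= 1 -> `|wtail l u X b| <= 1 ->
  `|walsh l u b| <= K * C + 2.
Proof.
move=> lX X0 s1 K0 uL us bC h1 h2; rewrite (walsh_split _ _ lX).
apply: le_trans (ler_normD _ _) _.
have h3 : `|psum R b X * u X.+1| <= 1.
  apply: le_trans h1; rewrite normrM ler_wpM2l//; apply: le_trans (us _) _.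
  by apply: npow_anti => //; lra.
have h4 : `|\sum_(1 <= n < X.+1) psum R b n * (u n - u n.+1)| <= K * C.
  apply: le_trans (ler_wpM2l K0 (bC X)).
  apply: le_trans (ler_norm_sum _ _ _) _; rewrite mulr_sumr.
  rewrite big_nat_cond [leRHS]big_nat_cond; apply: ler_sum => n.
  rewrite andbT => /andP[n0 _]; rewrite normrM mulrCA ler_wpM2l//.
  apply: le_trans (uL _ n0) _; rewrite ler_wpM2l//; apply: npow_le; lra.
apply: (@le_trans _ _ ((K * C + 1) + 1)); last by lra.
by apply: lerD => //; apply: le_trans (ler_normD _ _) _; apply: lerD.
Qed.

(* The block in $(N, X]$ is independent of the signs that [Q] depends on, and
   its lower bound is chosen large enough to absorb the smallest value that
   the factors at the primes up to [N] can take. *)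
Lemma mass_le_step C N l (Q : (nat -> bool) -> bool) (e q : R) : 0 <= C ->
  complete_upto N l -> supported l Q -> (forall b, mass_le C b -> Q b) ->
  (forall b, prob R l Q b <= q) -> 0 < e ->
  exists N' l' (Q' : (nat -> bool) -> bool),
    [/\ complete_upto N' l', supported l' Q', forall b, mass_le C b -> Q' b &
        forall b, prob R l' Q' b <= 63 / 64 * q + e].
Proof.
move=> C0 lN Qs QC Qq e0.
have a0 : 0 < (1 / 16 : R) ^+ size l by rewrite exprn_gt0//; lra.
have [L0 L02 hL0] := exp_sqrt_beats_sqr 1306 a0 C0.
have [X0 [s [NX0 s1 s2 _ hK]]] := exists_large_weight N L0 ltr01.
pose d := 2 * s - 1; have d0 : 0 < d by rewrite /d; lra.
(* The exponent [s] is fixed before the cut-off, so [X] can be taken so large in terms of [s] that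
   each of the three truncation errors exceeds 1 with probability at most [e / 3]. *)
have [X1 X10 hX1] := @npow_small R d (e / 3 * d) d0 ltac:(nra).
pose X := maxn X0 X1.
have X0X : (X0 <= X)%N by rewrite leq_maxl.
have X1X : (X1 <= X)%N by rewrite leq_maxr.
have Xp : (0 < X)%N by apply: leq_trans X1X.
have NX : (N <= X)%N by apply: leq_trans X0X.
pose l2 := primes_in N X; pose l' := l2 ++ l.
have lX : complete_upto X l' by apply: complete_uptoS.
have lP := complete_upto_prime lN; have lP' := complete_upto_prime lX.
have l2P : all_prime l2 by move=> p; exact: primes_in_prime.
have s1' : 1 / 2 <= s by lra.
pose L := \sum_(p <- l2) npow (2 * s) p; have LL0 : L0 <= L by apply: hK.
have [|t [t0 tL hE]] := prob_euler_sqr_ge l2P (primes_in_uniq N X) s1' (erefl L).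
  by apply: le_trans LL0.
clearbody L; move: (hL0 _ LL0) hE (expR_ge0 (Num.sqrt ((L - 1) / 2) / 6 - 1306)).
move: (expR _) => x hx hE x0; have {L02 LL0} L2 : 2 <= L by apply: le_trans LL0.
pose E b := x <= euler_sqr l2 s t b.
pose R1 b := `|psum R b X| * npow s X <= 1.
pose R2 b := `|wtail l' (dcos s t) X b| <= 1.
pose R3 b := `|wtail l' (dsin s t) X b| <= 1.
(* Bounded mass is incompatible with [E], [R1], [R2], [R3] holding together, so their conjunction
   can be removed from [Q]. *)
pose Q' b := Q b && ~~ [&& E b, R1 b, R2 b & R3 b].
have rem : npow d X <= e / 3 /\ npow d X / d <= e / 3.
  have h := hX1 _ X1X; split; last by rewrite ler_pdivrMr.
  by apply: le_trans h _; rewrite /d; nra.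
exists X, l', Q'; split => //.
- move=> b b' bb'; rewrite /Q' /E /R1 /R2 /R3.
  have bl p : p \in l -> b p = b' p by move=> pl; apply: bb'; rewrite mem_cat pl orbT.
  have bl2 p : p \in l2 -> b p = b' p by move=> pl; apply: bb'; rewrite mem_cat pl.
  rewrite (Qs b b' bl) (@supported_euler_sqr R l2 s t b b' bl2).
  rewrite (@supported_psum R X l' lX b b' bb').
  by rewrite /wtail !(@supported_walsh R l' _ lP' b b' bb').
(* Here the squared modulus of the whole Euler product would be at least [(1 / 16) ^+ size l * x]
   and at most [2 * ((1 + L) * C + 2) ^+ 2], against the choice of [L0]. *)
- move=> b bC; rewrite /Q' (QC _ bC) /=; apply/negP => /and4P[bE b1 b2 b3].
  have K0 : 0 <= 1 + L by lra.
  have kb : s + `|t| <= 1 + L by rewrite ger0_norm//; lra.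
  have s0 : 0 <= s by lra.
  have hc : `|walsh l' (dcos s t) b| <= (1 + L) * C + 2.
    apply: (norm_walsh_le lX Xp s1' K0 _ (norm_dcos s t) bC b1 b2) => n n0.
    by apply: le_trans (dcosS_lip t s0 n0) _; rewrite ler_wpM2r ?npow_ge0.
  have hs : `|walsh l' (dsin s t) b| <= (1 + L) * C + 2.
    apply: (norm_walsh_le lX Xp s1' K0 _ (norm_dsin s t) bC b1 b3) => n n0.
    by apply: le_trans (dsinS_lip t s0 n0) _; rewrite ler_wpM2r ?npow_ge0.
  have := walsh_mult2 b lP' lX.1 (dcos_1 s t) (dsin_1 s t) (@dcosM R s t) (@dsinM R s t).
  have sq (z y : R) : `|z| <= y -> z ^+ 2 <= y ^+ 2.
    move=> xy; rewrite -real_normK ?num_real//; apply: lerXn2r => //.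
    by rewrite nnegrE (le_trans _ xy).
  have : (1 / 16) ^+ size l * x <=
      \prod_(p <- l') ((1 + eps R b p * dcos s t p) ^+ 2 + dsin s t p ^+ 2).
    rewrite big_cat /= [leRHS]mulrC; apply: ler_pM.
    - exact: ltW.
    - exact: x0.
    - exact: euler_sqr_ge.
    - exact: bE.
  move: hx; have := sq _ _ hc; have := sq _ _ hs.
  move: (\prod_(_ <- _) _) (_ ^+ size l) (_ * C) (walsh _ _ _ ^+ 2) (walsh _ _ _ ^+ 2).
  by move=> y z w u v; move: (z * x) ((w + 2) ^+ 2) => ? ? *; lra.
- move=> b.
  apply: (@le_trans _ _ (prob R l' (fun b => (Q b && ~~ E b) ||
      (~~ R1 b || (~~ R2 b || ~~ R3 b))) b)).
    apply: prob_le => {}b; rewrite /Q' !negb_and andb_orr.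
    by move=> /orP[->//|/andP[_ ->]]; rewrite orbT.
  apply: le_trans (probU R _ _ _ _) _; apply: lerD.
    (* The new block is averaged first: [Q] does not depend on it and comes out as a factor, while
       [~~ E] has mean at most [63 / 64]. *)
    rewrite /prob avg_cat.
    apply: (@le_trans _ _ (avg l (fun b => 63 / 64 * (Q b)%:R) b)); last first.
      by rewrite avg_scale ler_wpM2l ?Qq//; lra.
    apply: avg_le => {}b.
    have Qa : avoids l2 (fun b => (Q b)%:R : R).
      move=> c c' cc'; rewrite (Qs c c')// => p pl; apply: cc'.
      by apply/negP => pl2; move: lX.1; rewrite cat_uniq => /and3P[_ /hasPn /(_ _ pl) /negP].
    rewrite (@avg_eq _ _ _ (fun b => (~~ E b)%:R * (Q b)%:R)); last first.
      by move=> c; rewrite -natrM mulnb andbC.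
    rewrite (avg_mulr _ _ Qa) ler_wpM2r ?ler0n//.
    rewrite (@avg_eq _ _ _ (fun b => 1 + -1 * (E b)%:R)); last first.
      by move=> c; case: (E c) => /=; lra.
    rewrite avgD avg_scale avg_cst; have := hE b; rewrite -/(prob R l2 E b) /E.
    by set z := prob _ _ _ _; lra.
  have [r1 r2] := rem.
  apply: (@le_trans _ _ (e / 3 + (e / 3 + e / 3))); last by lra.
  apply: le_trans (probU R _ _ _ _) _; apply: lerD.
    exact: le_trans (prob_psum_large _ _ lX Xp) r1.
  apply: le_trans (probU R _ _ _ _) _; apply: lerD; apply: le_trans r2.
    exact: prob_wtail_large (norm_dcos s t).
  exact: prob_wtail_large (norm_dsin s t).
Qed.

Lemma expr_small (x e : R) : 0 <= x -> x < 1 -> 0 < e -> exists k, x ^+ k <= e.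
Proof.
move=> x0 x1 e0; have x1' : `|x| < 1 by rewrite ger0_norm.
have /cvgrPdist_le /(_ _ e0) [k _ hk] := @cvg_expr R x x1'.
by exists k; have := hk k (leqnn k); rewrite sub0r normrN ger0_norm// exprn_ge0.
Qed.

Lemma mass_le_cylnull C : 0 <= C -> cylnull (mass_le C).
Proof.
move=> C0 e e0.
have [k hk] := @expr_small (127 / 128) e ltac:(lra) ltac:(lra) e0.
have [N [l [Q [lN Ql QC Qk]]]] : exists N l (Q : (nat -> bool) -> bool),
    [/\ complete_upto N l, supported l Q, forall b, mass_le C b -> Q b &
        forall b, prob R l Q b <= (127 / 128) ^+ k].
  elim: {hk} k => [|k [N [l [Q [lN Ql QC Qk]]]]].
    exists 0%N, [::], xpredT; split => //.
    by split=> // -[|p]; rewrite ?andbF.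
  (* The error allowed is [1 / 128] of the current bound, as [63 / 64 + 1 / 128 = 127 / 128]. *)
  have p0 : 0 < (127 / 128 : R) ^+ k / 128 by rewrite divr_gt0// exprn_gt0//; lra.
  have [N' [l' [Q' [h1 h2 h3 h4]]]] := mass_le_step C0 lN Ql QC Qk p0.
  exists N', l', Q'; split => // b; apply: le_trans (h4 b) _; rewrite exprS.
  by move: (_ ^+ k) => z; lra.
exists l, Q; split => //; [exact: lN.1|exact: complete_upto_prime lN|].
by move=> b; apply: le_trans hk.
Qed.

End BoundedMassIsNull.

(** * One-sided bounds imply absolute convergence *)

Section Oscillation.
Variable R : realType.
Implicit Types (l : seq nat) (b : nat -> bool) (s t : R).

Lemma avg_prod l (g : nat -> bool -> R) b : uniq l ->
  avg l (fun b => \prod_(p <- l) g p (b p)) b =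
  \prod_(p <- l) ((g p true + g p false) / 2).
Proof.
elim: l b => [|p l IH] b /=; first by rewrite !big_nil.
move=> /andP[pl ul]; rewrite big_cons -(IH b ul) -avg_scale.
apply: avg_eq => {}b; rewrite /mean !big_cons /update eqxx.
have h v : \prod_(q <- l) g q (if q == p then v else b q) = \prod_(q <- l) g q (b q).
  by apply: eq_big_seq => q ql; case: eqVneq => // qp; rewrite -qp ql in pl.
by rewrite !h; field.
Qed.

(** With [x], [y] the two square roots, [x * y <= 1 - a^2 / 2], so the square of their mean is at
    most [1 - a^2 / 4], hence at most [(1 - a^2 / 8)^2]. *)
Lemma mean_sqrt_le (a : R) : 0 <= a -> a <= 1 ->
  (Num.sqrt (1 + a) + Num.sqrt (1 - a)) / 2 <= expR (- (a ^+ 2 / 8)).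
Proof.
move=> a0 a1; apply: le_trans (expR_ge1Dx _).
have [x0 x2] : 0 <= Num.sqrt (1 + a) /\ Num.sqrt (1 + a) ^+ 2 = 1 + a.
  by split; [exact: sqrtr_ge0 | rewrite sqr_sqrtr//; lra].
have [y0 y2] : 0 <= Num.sqrt (1 - a) /\ Num.sqrt (1 - a) ^+ 2 = 1 - a.
  by split; [exact: sqrtr_ge0 | rewrite sqr_sqrtr//; lra].
move: x0 x2 y0 y2; move: (Num.sqrt (1 + a)) (Num.sqrt (1 - a)) => x y x0 x2 y0 y2.
have xy : x * y <= 1 - a ^+ 2 / 2.
  rewrite -ler_sqr ?nnegrE ?mulr_ge0//; last by nra.
  by rewrite exprMn x2 y2; nra.
have l0 : 0 <= (x + y) / 2 by lra.
have r0 : 0 <= 1 - a ^+ 2 / 8 by nra.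
rewrite -ler_sqr ?nnegrE//.
have -> : ((x + y) / 2) ^+ 2 = (x ^+ 2 + y ^+ 2 + 2 * (x * y)) / 4 by field.
by rewrite x2 y2; have := sqr_ge0 (a ^+ 2); nra.
Qed.

(* Markov's inequality for the square root of the Euler product, whose mean
   tends to 0 although the Euler product itself has mean 1. *)
Lemma prob_walsh_npow_large l s b : all_prime l -> uniq l -> 0 <= s ->
  prob R l (fun b => ~~ (`|walsh l (npow s) b| <= 1)) b <=
  expR (- ((\sum_(p <- l) npow (2 * s) p) / 8)).
Proof.
move=> lP ul s0.
have e c : walsh l (npow s) c = \prod_(p <- l) (1 + eps R c p * npow s p).
  by apply: walsh_mult => //; [exact: npow_1 | exact: npowM].
have f0 c p : 0 <= 1 + eps R c p * npow s p.
  by have := npow_le1 p s0; have := npow_ge0 s p; rewrite /eps; case: (c p); lra.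
apply: le_trans (@markov R l _ (fun b => \prod_(p <- l)
   Num.sqrt (1 + (if b p then 1 else -1) * npow s p)) b _ _) _.
- by move=> c; apply: prodr_ge0 => p _; exact: sqrtr_ge0.
- move=> c; rewrite -ltNge e ger0_norm ?prodr_ge0// => /ltW h.
  have P0 : 0 <= \prod_(p <- l) Num.sqrt (1 + (if c p then 1 else -1) * npow s p).
    by apply: prodr_ge0 => p _; exact: sqrtr_ge0.
  rewrite -ler_sqr ?nnegrE//.
  rewrite expr1n -prodrXl; apply: le_trans h _.
  by rewrite le_eqVlt; apply/orP; left; apply/eqP/eq_bigr => p _; rewrite sqr_sqrtr ?(f0 c p).
rewrite (avg_prod (fun p v => Num.sqrt (1 + (if v then 1 else -1) * npow s p)))//.
rewrite mulr_suml -sumrN expR_sum; apply: ler_prod => p _.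
rewrite divr_ge0 ?addr_ge0 ?sqrtr_ge0//= -npow_sqr mul1r mulN1r.
exact: mean_sqrt_le (npow_ge0 _ _) (npow_le1 _ s0).
Qed.

(** As [n^(-s) - (n+1)^(-s)] is the integral of [s x^(-s-1)] over [[n, n+1]], this is
    [s \int a(x) x^(-s-1) dx] over [[1, X+1]] for the step function [a]. *)
Definition damped_sum (a : nat -> R) s X : R :=
  \sum_(1 <= n < X.+1) a n * (npow s n - npow s n.+1).

(** The exceptional event: when it fails for all [d > 0] and [X0], there are [s] tending to 1/2,
    with [X] arbitrarily large, along which the damped sums stay bounded. *)
Definition damped_large (d : R) (X0 : nat) b : Prop :=
  forall s X, 1 / 2 < s -> s <= 1 -> s < 1 / 2 + d -> (X0 <= X)%N ->
    3 < `|damped_sum (psum R b) s X|.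

(** One pair [(s, X)] suffices. By [walsh_split] the damped sum is the Euler product minus the
    boundary term and the tail; each of the three exceeds 1 in modulus with probability at most
    [e / 3], hence the threshold 3. *)
Lemma damped_large_cylnull d X0 : 0 < d -> cylnull R (damped_large d X0).
Proof.
move=> d0 e e0.
(* This weight makes the bound of [prob_walsh_npow_large] at most [e / 3]. *)
have [X' [s [_ s1 s2 sd hK]]] := exists_large_weight 0 (8 * - ln (e / 3)) d0.
pose c := 2 * s - 1; have c0 : 0 < c by rewrite /c; lra.
have [X1 X10 hX1] := @npow_small R c (e / 3 * c) c0 ltac:(nra).
pose X := maxn X0 (maxn X' X1).
have X0X : (X0 <= X)%N by rewrite leq_maxl.
have X'X : (X' <= X)%N by rewrite /X !leq_max leqnn !orbT.
have X1X : (X1 <= X)%N by rewrite /X !leq_max leqnn !orbT.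
have Xp : (0 < X)%N by apply: leq_trans X1X.
have lX := complete_upto_primes_in X; set l := primes_in 0 X in lX.
have lP := complete_upto_prime lX; have ul := lX.1.
have s0 : 0 <= s by lra.
have un n : `|npow s n| <= npow s n by rewrite ger0_norm// npow_ge0.
pose R0 b := `|walsh l (npow s) b| <= 1.
pose R1 b := `|psum R b X| * npow s X <= 1.
pose R2 b := `|wtail l (npow s) X b| <= 1.
exists l, (fun b => ~~ R0 b || (~~ R1 b || ~~ R2 b)); split => //.
- move=> b b' bb'; rewrite /R0 /R1 /R2 /wtail.
  by rewrite !(@supported_walsh R l _ lP b b' bb') (@supported_psum R X l lX b b' bb').
- move=> b /(_ s X s1 s2 sd X0X); apply: contraTT; rewrite -leNgt !negb_or !negbK.
  move=> /and3P[b0 b1 b2]; have := walsh_split (npow s) b lX; rewrite -/(damped_sum _ _ _).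
  have b3 : `|psum R b X * npow s X.+1| <= 1.
    apply: le_trans b1; rewrite normrM ler_wpM2l// ger0_norm ?npow_ge0//.
    exact: npow_anti.
  move: b0 b2 b3; rewrite /R0 /R2 !ler_norml; move: (walsh _ _ _) (wtail _ _ _ _).
  move=> x y /andP[? ?] /andP[? ?] /andP[? ?] ?; apply/andP; split; lra.
move=> b.
apply: (@le_trans _ _ (e / 3 + (e / 3 + e / 3))); last by lra.
have h1 := hX1 _ X1X.
apply: le_trans (probU R _ _ _ _) _; apply: lerD.
  apply: le_trans (prob_walsh_npow_large _ lP ul s0) _.
  rewrite -[leRHS]lnK ?posrE; last by lra.
  by rewrite ler_expR; have := hK _ X'X; lra.
apply: le_trans (probU R _ _ _ _) _; apply: lerD.
  by apply: le_trans (prob_psum_large _ _ lX Xp) _; apply: le_trans h1 _; rewrite /c; nra.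
by apply: le_trans (prob_wtail_large _ lX Xp s1 un) _; rewrite ler_pdivrMr.
Qed.

(** From [n + 1 <= 2 n] and [s <= 1] one gets [(n + 1)^(-s-1) >= n^(-s-1) / 4]; the factor
    [s >= 1/2] in [npowS_ge] then gives [1/8]. *)
Lemma npow_weight_ge s n : 1 / 2 <= s -> s <= 1 -> (0 < n)%N ->
  1 / 8 * npow (s + 1) n <= npow s n - npow s n.+1.
Proof.
move=> s1 s2 n0; have s0 : 0 <= s by lra.
apply: le_trans (npowS_ge s0 n0).
have h : npow (s + 1) (2 * n)%N <= npow (s + 1) n.+1.
  by apply: npow_anti => //; [lra | rewrite mul2n -addnn -addn1 leq_add2l].
have h2 : 1 / 4 <= npow (s + 1) 2.
  apply: (@le_trans _ _ (npow 2 2)); last by apply: npow_le; lra.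
  have -> : 2 = 1 + 1 :> R by [].
  by rewrite npowD npow1//; lra.
move: h; rewrite npowM// => h.
have h3 : 1 / 4 * npow (s + 1) n <= npow (s + 1) 2 * npow (s + 1) n.
  by rewrite ler_wpM2r ?npow_ge0.
have h4 : 1 / 2 * npow (s + 1) n.+1 <= s * npow (s + 1) n.+1.
  by rewrite ler_wpM2r ?npow_ge0.
by move: h h3 h4; move: (npow _ 2 * _) (_ * npow _ n.+1) => x y; lra.
Qed.

(** A discrete monotone convergence argument: [|M n| <= M n + 2 ell n] makes the one-sided bound
    absolute for the weights [n^(-s) - (n+1)^(-s)], and for [s] near 1/2 these dominate
    [n^(-3/2) / 16] up to [X']. The final bound is uniform in [X']. *)
Lemma summable_of_damped_sum (M : nat -> R) (ell : nat -> R) (B : R) :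
  (forall n, 0 <= ell n) -> (forall n, (0 < n)%N -> - ell n <= M n) ->
  (forall X, \sum_(1 <= n < X.+1) ell n * npow (3 / 2) n <= B) ->
  (forall d X0, 0 < d -> exists s X, [/\ 1 / 2 < s, s <= 1, s < 1 / 2 + d,
     (X0 <= X)%N & `|damped_sum M s X| <= 3]) ->
  forall X, \sum_(1 <= n < X.+1) `|M n| * npow (3 / 2) n <= 16 * (3 + 2 * B).
Proof.
move=> l0 Ml lB hM X'.
(* This [d] forces [(s - 1/2) ln X' <= 1/2], hence [n^(-(s - 1/2)) >= 1/2] for [n <= X']; with the
   [1/8] of [npow_weight_ge] this gives the factor 16. *)
have L0 := ln_nat_ge0 R X'; pose d : R := 1 / (2 * (1 + ln X'%:R)).
have d0 : 0 < d by rewrite divr_gt0//; lra.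
have [s [X [s1 s2 sd XX hs]]] := hM d X' d0.
have dL : d * (2 * (1 + ln X'%:R)) = 1 by rewrite divfK// gt_eqF//; lra.
have s0 : 0 <= s by lra.
pose w n := npow s n - npow s n.+1.
have w0 n : (0 < n)%N -> 0 <= w n by move=> n0; rewrite subr_ge0 npow_anti.
have w1 n : (0 < n)%N -> w n <= npow (3 / 2) n.
  move=> n0; apply: le_trans (npowS_le s0 n0) _; apply: (@le_trans _ _ (npow (s + 1) n)).
    by rewrite ler_piMl ?npow_ge0.
  by apply: npow_le; lra.
have w2 n : (0 < n)%N -> (n <= X')%N -> npow (3 / 2) n <= 16 * w n.
  move=> n0 nX; have h := npow_weight_ge (ltW s1) s2 n0.
  have : 1 / 2 <= npow (s - 1 / 2) n.
    apply: (@le_trans _ _ (npow (s - 1 / 2) X')); last by apply: npow_anti => //; lra.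
    by apply: le_trans (expR_ge1Dx _); nra.
  have e : 3 / 2 + (s - 1 / 2) = s + 1 by lra.
  rewrite -(ler_pM2l (npow_gt0 (3 / 2) n)) -npowD e => h2.
  by move: h h2; rewrite -/(w n); move: (npow _ _) (npow _ _) => x y; lra.
apply: (@le_trans _ _ (\sum_(1 <= n < X'.+1) 16 * (`|M n| * w n))).
  rewrite big_nat_cond [leRHS]big_nat_cond; apply: ler_sum => n.
  rewrite andbT => /andP[n0 nX]; rewrite mulrCA; apply: ler_wpM2l => //.
  exact: w2.
rewrite -mulr_sumr; apply: ler_wpM2l; first exact: ler0n.
apply: (@le_trans _ _ (\sum_(1 <= n < X.+1) `|M n| * w n)).
  rewrite big_nat_cond [leRHS](@big_cat_nat _ _ _ X'.+1)//=.
  rewrite -big_nat_cond lerDl big_nat_cond; apply: sumr_ge0 => n.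
  rewrite andbT => /andP[n0 _]; apply: mulr_ge0 => //; apply: w0.
  exact: leq_trans n0.
apply: (@le_trans _ _ (damped_sum M s X + 2 * \sum_(1 <= n < X.+1) ell n * npow (3 / 2) n)).
  rewrite /damped_sum mulr_sumr -big_split /= big_nat_cond [leRHS]big_nat_cond.
  apply: ler_sum => n; rewrite andbT => /andP[n0 _]; rewrite -/(w n).
  have h1 : `|M n| <= M n + 2 * ell n.
    by rewrite ler_norml; have := Ml _ n0; have := l0 n => ? ?; apply/andP; split; lra.
  apply: le_trans (ler_wpM2r (w0 _ n0) h1) _; rewrite mulrDl lerD2l -mulrA.
  by rewrite ler_wpM2l// ler_wpM2l// w1.
by have := lB X; move: hs; rewrite ler_norml => /andP[_]; lra.
Qed.

(** The finitely many [n] below [n0] are absorbed by adding [|M n|] to [ell n] there. *)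
Lemma summable_of_eventual_bound (M : nat -> R) (ell : nat -> R) (B : R) (n0 : nat) :
  (forall n, 0 <= ell n) -> (forall n, (n0 <= n)%N -> - ell n <= M n) ->
  (forall X, \sum_(1 <= n < X.+1) ell n * npow (3 / 2) n <= B) ->
  (forall d X0, 0 < d -> exists s X, [/\ 1 / 2 < s, s <= 1, s < 1 / 2 + d,
     (X0 <= X)%N & `|damped_sum M s X| <= 3]) ->
  exists C, forall X, \sum_(1 <= n < X.+1) `|M n| * npow (3 / 2) n <= C.
Proof.
move=> l0 Ml lB hM.
pose a n : R := if (n < n0)%N then `|M n| else 0.
pose S := \sum_(n <- iota 0 n0) `|M n| * npow (3 / 2) n.
exists (16 * (3 + 2 * (B + S))) => X.
apply: (@summable_of_damped_sum M (fun n => ell n + a n)) => //.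
- by move=> n; rewrite /a; case: ifP => _; rewrite ?addr0// addr_ge0.
- move=> n _; rewrite /a; have := l0 n; case: (ltnP n n0) => [_|/Ml]; last by lra.
  by have := ler_norm (- M n); rewrite normrN; lra.
move=> Y; under eq_bigr do rewrite mulrDl.
rewrite big_split /=; apply: lerD => //.
apply: (@le_trans _ _ (\sum_(n <- index_iota 1 Y.+1 | (n < n0)%N) `|M n| * npow (3 / 2) n)).
  rewrite [leRHS]big_mkcond; apply: ler_sum => n _; rewrite /a.
  by case: ifP => _; rewrite ?mul0r.
rewrite -big_filter; apply: ler_sum_uniq_sub.
- by rewrite filter_uniq// iota_uniq.
- exact: iota_uniq.
- by move=> n; rewrite mem_filter mem_iota add0n => /andP[].
- by move=> n; rewrite mulr_ge0// npow_ge0.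
Qed.

End Oscillation.

(** * From signs to the probability space *)

Section Transfer.
Context d (T : measurableType d) (R : realType) (P : probability T R).
Variable f : nat -> {RV P >-> R}.
Hypothesis hf : rademacher_rmf f.

(** Every value other than 1 is read as -1; at a prime, values other than 1 and -1 have probability
    0. *)
Definition signs (t : T) : nat -> bool := fun p => f p t == 1.

Let fiber p (v : bool) : set T := [set t | signs t p = v].

Let fiberE p v : fiber p v = f p @^-1` (if v then [set 1] else ~` [set 1]).
Proof.
apply/seteqP; split=> t; rewrite /fiber /signs /=; case: v => /=.
- by move/eqP.
- by move=> /negbT/eqP.
- by move=> /= ->; rewrite eqxx.
- by move=> /= /eqP/negbTE.
Qed.

Let msign (v : bool) : measurable (if v then [set 1] else ~` [set 1] : set R).
Proof. by case: v => //; apply: measurableC. Qed.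

Let measurable_fiber p v : measurable (fiber p v).
Proof. by rewrite fiberE; apply: measurable_funPTI. Qed.

Let prob_fiber p v : prime p -> P (fiber p v) = (2^-1)%:E.
Proof.
move=> pp; rewrite fiberE; case: v; first exact: rmf_prime_pos.
rewrite -preimage_setC probability_setC; last first.
  by apply: measurable_funPTI.
by rewrite (rmf_prime_pos hf pp) -EFinB; congr (_%:E); lra.
Qed.

Let cyl (J : seq nat) (e : nat -> bool) : set T :=
  [set t | forall q, q \in J -> signs t q = e q].

Let cyl_cons p J e v : p \notin J ->
  cyl (p :: J) (update e p v) = fiber p v `&` cyl J e.
Proof.
move=> pJ; apply/seteqP; split=> t.
  move=> h; split=> [|q qJ]; first by rewrite /fiber /= h ?mem_head// /update eqxx.
  rewrite h ?inE ?qJ ?orbT// /update; case: eqVneq => // qp.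
  by rewrite -qp qJ in pJ.
move=> [h1 h2] q; rewrite inE /update; case: eqVneq => [->//|_ /= qJ]; exact: h2.
Qed.

Let measurable_cyl J e : measurable (cyl J e).
Proof.
have -> : cyl J e = \bigcap_(q in [set` J]) fiber q (e q) by [].
by apply: bigcap_measurableType.
Qed.

Let prob_cyl J e : uniq J -> all_prime J -> P (cyl J e) = ((2^-1) ^+ size J)%:E.
Proof.
move=> uJ JP; pose K : {fset nat} := [fset q in J]%fset.
have KJ q : (q \in K) = (q \in J) by rewrite !inE.
pose B q : set R := if e q then [set 1] else ~` [set 1].
have -> : cyl J e = \bigcap_(q in [set` K]) (f q @^-1` B q).
  rewrite -(eq_bigcapr (fun q _ => fiberE q (e q))).
  apply/seteqP; split=> t h q; first by rewrite /= KJ; exact: h.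
  by move=> qJ; apply: h; rewrite /= KJ.
rewrite (rmf_indep hf); last 2 first.
- by move=> q /=; rewrite KJ => /JP.
- by move=> q _; exact: msign.
have -> : (\prod_(i <- K) P (f i @^-1` B i))%E =
    (\prod_(i <- J) (2^-1)%:E)%E.
  rewrite (perm_big J) /=; last by apply: uniq_perm; [exact: fset_uniq | exact: uJ | exact: KJ].
  by apply: eq_big_seq => q qJ; rewrite /B -fiberE prob_fiber//; exact: JP.
elim: (J) => [|q J' IH]; first by rewrite big_nil.
by rewrite big_cons IH /= exprS EFinM.
Qed.

(** Induction on [l], with [J] the primes whose signs are already prescribed: splitting by the sign
    at the next prime mirrors [mean], and once [l] is exhausted [Q] is constant on the cylinder. *)
Let measurable_event l J (Q : (nat -> bool) -> bool) e : uniq (J ++ l) ->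
  all_prime (J ++ l) -> supported (J ++ l) Q ->
  measurable (cyl J e `&` [set t | Q (signs t)]) /\
  P (cyl J e `&` [set t | Q (signs t)]) = ((2^-1) ^+ size J * prob R l Q e)%:E.
Proof.
elim: l J e => [|p l IH] J e uJ JP Qs.
  rewrite cats0 in uJ JP Qs.
  have Qe t : cyl J e t -> Q (signs t) = Q e by move=> h; apply: Qs.
  rewrite /prob /=; case QeE: (Q e).
    have -> : cyl J e `&` [set t | Q (signs t)] = cyl J e.
      by apply/setIidPl => t /Qe /=; rewrite QeE => ->.
    by rewrite prob_cyl// mulr1.
  have -> : cyl J e `&` [set t | Q (signs t)] = set0.
    by apply/seteqP; split=> // t [/Qe /=]; rewrite QeE => ->.
  by rewrite measure0 mulr0.
have pJ : p \notin J.
  by move: uJ; rewrite cat_uniq /= negb_or => /and3P[_ /andP[]].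
have pl : p \notin l by move: uJ; rewrite cat_uniq /= => /and3P[_ _ /andP[]].
have pe : perm_eq (J ++ p :: l) ((p :: J) ++ l).
  by rewrite -cat1s perm_catCA.
have uJ' : uniq ((p :: J) ++ l) by rewrite -(perm_uniq pe).
have JP' : all_prime ((p :: J) ++ l) by move=> q; rewrite -(perm_mem pe); exact: JP.
have Qs' : supported ((p :: J) ++ l) Q.
  by move=> b b' bb'; apply: Qs => q; rewrite (perm_mem pe); exact: bb'.
have [m1 e1] := IH (p :: J) (update e p true) uJ' JP' Qs'.
have [m2 e2] := IH (p :: J) (update e p false) uJ' JP' Qs'.
have -> : cyl J e `&` [set t | Q (signs t)] =
    (cyl (p :: J) (update e p true) `&` [set t | Q (signs t)]) `|`
    (cyl (p :: J) (update e p false) `&` [set t | Q (signs t)]).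
  rewrite !cyl_cons// -setIUl -setIUl; congr (_ `&` _).
  apply/seteqP; split=> t; last by case.
  by move=> ht; split=> //; case E: (signs t p); [left|right].
split; first exact: measurableU.
rewrite measureU//; last first.
  apply/seteqP; split=> // t; rewrite !cyl_cons// => -[[[h _] _] [[h' _] _]].
  by move: h h'; rewrite /fiber /= => ->.
apply: etrans; first by apply: (congr2 _ e1 e2).
rewrite /prob -EFinD /= avg_mean// /mean; congr (_%:E).
by rewrite exprS; move: (avg _ _ _) (avg _ _ _) (_ ^+ _) => x y z; field.
Qed.

Lemma prob_signs l (Q : (nat -> bool) -> bool) e : uniq l -> all_prime l ->
  supported l Q ->
  measurable [set t | Q (signs t)] /\
  P [set t | Q (signs t)] = (prob R l Q e)%:E.
Proof.
move=> ul lP Ql; have := @measurable_event l [::] Q e ul lP Ql.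
by rewrite (_ : cyl [::] e = setT) ?setTI ?expr0 ?mul1r//; apply/seteqP; split.
Qed.

(** The set need not be measurable; it lies in the intersection of the covering events for
    [e = 1 / (k + 1)], which has measure 0. *)
Lemma cylnull_negligible (A : (nat -> bool) -> Prop) :
  cylnull R A -> P.-negligible [set t | A (signs t)].
Proof.
move=> hA.
have /choice [B hB] (k : nat) : exists B : set T,
    [/\ measurable B, [set t | A (signs t)] `<=` B & (P B <= (k.+1%:R^-1)%:E)%E].
  have [|l [Q [ul lP Ql AQ Qe]]] := hA k.+1%:R^-1; first by rewrite invr_gt0.
  have [mQ PQ] := prob_signs xpredT ul lP Ql.
  by exists [set t | Q (signs t)]; split=> //; [move=> t /AQ | rewrite PQ lee_fin].
exists (\bigcap_k B k); split.
- by apply: bigcap_measurableType => k _; have [] := hB k.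
- apply/eqP; rewrite eq_le measure_ge0 andbT; apply/lee_addgt0Pr => e e0.
  rewrite add0e; have [k _ hk] := near_infty_natSinv_lt (PosNum e0).
  have [mB _ PB] := hB k.
  apply: (@le_trans _ _ (P (B k))).
    apply: le_measure; rewrite ?inE//.
      by apply: bigcap_measurableType => i _; have [] := hB i.
    exact: bigcap_inf.
  apply: le_trans PB _; rewrite lee_fin ltW//; exact: (hk k (leqnn k)).
- by move=> t At k _; have [_ AB _] := hB k; exact: AB.
Qed.

(** The exceptional set is the countable union, over the primes, of the null events that [f p] is
    neither 1 nor -1; it serves all [n] at once. *)
Lemma rmf_signs_ae :
  {ae P, forall t, forall n, (0 < n)%N -> f n t = rmf R (signs t) n}.
Proof.
have h p : prime p -> P.-negligible [set t | f p t <> 1 /\ f p t <> -1].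
  move=> pp.
  have m1 : measurable (f p @^-1` [set 1]) by apply: measurable_funPTI.
  have m2 : measurable (f p @^-1` [set -1]) by apply: measurable_funPTI.
  have PU : P (f p @^-1` [set 1] `|` f p @^-1` [set -1]) = 1%E.
    rewrite measureU//; last first.
      apply/seteqP; split=> // t [/= -> ] h; exfalso; lra.
    apply: etrans; first exact: (congr2 _ (rmf_prime_pos hf pp) (rmf_prime_neg hf pp)).
    by rewrite -EFinD; congr (_%:E); lra.
  exists (~` (f p @^-1` [set 1] `|` f p @^-1` [set -1])); split.
  - exact/measurableC/measurableU.
  - by rewrite probability_setC ?PU ?subee//; exact: measurableU.
  - by move=> t [h1 h2] [].
have hU : P.-negligible (\bigcup_p [set t | prime p /\ (f p t <> 1 /\ f p t <> -1)]).
  apply: negligible_bigcup => p; case: (boolP (prime p)) => pp.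
    by apply: negligibleS (h _ pp) => t [].
  by apply: negligibleS (negligible_set0 _) => t [].
apply: negligibleS hU => t /= /existsNP[n /not_implyP[n0 hn]].
apply: contrapT => hp; apply: hn.
have fE p : prime p -> f p t = eps R (signs t) p.
  move=> pp; rewrite /eps /signs; case: eqP => // f1.
  by apply: contrapT => f2; apply: hp; exists p.
rewrite /rmf; case: asboolP => sn; last exact: (rmf_nonsquarefree hf).
rewrite (rmf_squarefree hf)// /phi; apply: eq_big_seq => p.
by rewrite mem_primes => /andP[/fE].
Qed.

End Transfer.

(** * The perturbation *)

Section Perturbation.
Variable R : realType.

(** On a set of measure 1, [g] takes a value not exceeding its integral plus a positive slack; the
    slacks [(1 / 2)^(n+1)] add up to at most 1. *)
Lemma exists_small_values d (T : measurableType d) (mu : {measure set T -> \bar R})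
    (F : nat -> set T) (g : T -> R) :
  (forall n, measurable (F n)) -> trivIset setT F -> (forall n, mu (F n) = 1%E) ->
  (forall x, 0 <= g x) -> mu.-integrable (\bigcup_n F n) (EFin \o g) ->
  exists (c : nat -> R) (B : R), [/\ forall n, 0 <= c n,
    forall X, \sum_(0 <= n < X) c n <= B &
    forall n, exists2 u, F n u & g u <= c n].
Proof.
move=> mF tF F1 g0 ig.
have mg := measurable_int mu ig.
have mD : measurable (\bigcup_n F n) by exact: bigcup_measurable.
have gE0 x : (0 <= (EFin \o g) x)%E by rewrite lee_fin.
pose I n := (\int[mu]_(x in F n) (EFin \o g) x)%E.
have ID := ge0_integral_bigcup mu mF mg (fun x _ => gE0 x) tF.
have I0 n : (0 <= I n)%E by apply: integral_ge0.
have Dlt := integrable_lty mD ig.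
have Dge : (0 <= \int[mu]_(x in \bigcup_n F n) (EFin \o g) x)%E by apply: integral_ge0.
set J := (\int[mu]_(x in _) _)%E in ID Dlt Dge.
have Jfin : J \is a fin_num by rewrite ge0_fin_numE.
have sumI X : (\sum_(0 <= n < X) I n <= J)%E.
  by rewrite ID; apply: nneseries_lim_ge.
have FD n : F n `<=` \bigcup_n F n by exact: bigcup_sup.
have mFg n := measurable_funS mD (FD n) mg.
have ILt n : (I n < +oo)%E.
  apply: le_lt_trans Dlt; exact: ge0_subset_integral.
have Ifin n : I n \is a fin_num by rewrite ge0_fin_numE.
pose c n := fine (I n) + (1 / 2) ^+ n.+1.
have h0 n : 0 < (1 / 2 : R) ^+ n by rewrite exprn_gt0.
exists c, (fine J + 1); split.
- by move=> n; rewrite addr_ge0 ?fine_ge0// ltW.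
- move=> X; rewrite big_split /=; apply: lerD.
    rewrite -lee_fin fineK// -sumEFin.
    by under eq_bigr do rewrite fineK//; exact: sumI.
  suff -> : \sum_(0 <= n < X) (1 / 2 : R) ^+ n.+1 = 1 - (1 / 2) ^+ X.
    by have := h0 X; set y := _ ^+ X; lra.
  elim: X => [|X IH]; first by rewrite big_geq// expr0 subrr.
  by rewrite big_nat_recr//= IH exprS; move: (_ ^+ X) => z; lra.
move=> n; apply: contrapT => hn.
have cg x : F n x -> (cst (c n)%:E x <= (EFin \o g) x)%E.
  move=> Fx; rewrite lee_fin leNgt; apply/negP => /ltW gc.
  by apply: hn; exists x.
have c0 : 0 <= c n by rewrite addr_ge0 ?fine_ge0// ltW.
have := @ge0_le_integral _ _ _ mu (F n) (mF n) (cst (c n)%:E) (EFin \o g)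
  (fun _ _ => c0) (@measurable_cst _ _ _ _ _ _) (mFg n) cg.
rewrite integral_cst// F1 mule1 -/(I n) -(fineK (Ifin n)) lee_fin /c.
by have := h0 n.+1; lra.
Qed.

Lemma powR_npow (a : R) n : (0 < n)%N -> (n%:R : R) `^ a * npow a n = 1.
Proof.
move=> n0; rewrite /powR pnatr_eq0 -[n == 0%N]negbK -lt0n n0 /= /npow.
by rewrite -expRD subrr expR0.
Qed.

(** Since the partial sums are constant on [[n, n + 1)], it is enough to control [lambda] at one
    well-chosen point of each such interval. *)
Lemma perturbation_bound (lambda : R -> R) :
  completed_lebesgue_measure.-integrable `[1, +oo[%classic
    (fun u : R => (`|lambda u| / u `^ (3 / 2))%:E) ->
  exists (ell : nat -> R) (B : R), [/\ forall n, 0 <= ell n,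
    forall X, \sum_(1 <= n < X.+1) ell n * npow (3 / 2) n <= B &
    forall n, (0 < n)%N -> exists u, [/\ n%:R <= u, u < n.+1%:R & `|lambda u| <= ell n]].
Proof.
move=> hl; pose F n : set R := `[n.+1%:R, n.+2%:R[%classic.
have FD : `[1, +oo[%classic = \bigcup_n F n.
  apply/seteqP; split=> x; last first.
    move=> [n _]; rewrite /F /= !in_itv /= andbT => /andP[h _].
    by apply: le_trans h; rewrite ler1n.
  rewrite /= in_itv /= andbT => x1.
  have x0 : 0 <= x by apply: le_trans x1.
  have /andP[h1 h2] := truncn_itv x0.
  have t0 : (0 < Num.truncn x)%N by rewrite truncn_gt0.
  exists (Num.truncn x).-1 => //; rewrite /F /= in_itv /= prednK//.
  by rewrite h1 h2.
rewrite FD in hl.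
have [||||c [B [c0 cB cu]]] := @exists_small_values _ _
   (@completed_lebesgue_measure R) F (fun u => `|lambda u| / u `^ (3 / 2)) _ _ _ _ hl.
- by move=> n; apply: sub_caratheodory; exact: measurable_itv.
- apply/trivIsetP => i j _ _ ij; apply/seteqP; split=> // x.
  rewrite /F /= !in_itv /= => -[/andP[a1 a2] /andP[b1 b2]].
  have x1 : Num.truncn x = i.+1 by apply: truncn_def; rewrite a1 a2.
  have x2 : Num.truncn x = j.+1 by apply: truncn_def; rewrite b1 b2.
  by move: ij; rewrite -eqSS -x1 -x2 eqxx.
- move=> n; transitivity (lebesgue_measure (F n)); first by [].
  rewrite lebesgue_measure_itv /= lte_fin ltr_nat ltnSn -EFinB.
  by congr (_%:E); rewrite -[n.+2%:R]natr1 addrAC subrr add0r.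
- by move=> x; rewrite divr_ge0// powR_ge0.
(* The set [F n] is [[n + 1, n + 2)], hence the shift to [c n.-1]. The factor [(n + 1)^(3/2)] bounds
   [u^(3/2)] on [[n, n + 1)], and [4] bounds [((n + 1) / n)^(3/2)]. *)
exists (fun n => c n.-1 * n.+1%:R `^ (3 / 2)), (4 * B); split.
- by move=> n; rewrite mulr_ge0 ?powR_ge0.
- move=> X; apply: le_trans (ler_wpM2l (ler0n _ 4) (cB X)).
  rewrite big_add1 /= mulr_sumr; apply: ler_sum => n _ /=.
  rewrite -mulrA [leRHS]mulrC; apply: ler_wpM2l; first exact: c0.
  have h1 : npow (3 / 2) n.+2 * 4 >= npow (3 / 2) n.+1 :> R.
    have h2 : npow (3 / 2) (2 * n.+1)%N <= npow (3 / 2) n.+2 :> R.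
      by apply: npow_anti => //; rewrite mul2n -addnn !addSn ltnS leq_addl.
    have h3 : 1 / 4 <= npow (3 / 2) 2 :> R.
      apply: (@le_trans _ _ (npow 2 2)); last by apply: npow_le; lra.
      have -> : 2 = 1 + 1 :> R by [].
      by rewrite npowD npow1//; lra.
    move: h2; rewrite npowM//; have := npow_ge0 (3 / 2 : R) n.+1; nra.
  apply: le_trans (ler_wpM2l (powR_ge0 _ _) h1) _.
  by rewrite mulrA powR_npow// mul1r.
- move=> n n0; have [u Fu gu] := cu n.-1.
  move: Fu; rewrite /F /= in_itv /= prednK// => /andP[u1 u2].
  have u0 : 0 < u by apply: lt_le_trans u1; rewrite ltr0n.
  exists u; split => //.
  move: gu; rewrite ler_pdivrMr ?powR_gt0// => /le_trans; apply.
  apply: ler_wpM2l => //; apply: ge0_ler_powR; rewrite ?nnegrE//; exact: ltW.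
Qed.

(** The factor [c], equal to 1 or -1, treats both signs at once. At the sampled points [u] the sign
    condition gives [- ell n <= c * psum R b n] for large [n], so the one-sided criterion
    applies. *)
Lemma mass_le_of_eventual_sign (b : nat -> bool) (lambda : R -> R)
    (ell : nat -> R) (B c : R) : `|c| = 1 ->
  (forall n, 0 <= ell n) ->
  (forall X, \sum_(1 <= n < X.+1) ell n * npow (3 / 2) n <= B) ->
  (forall n, (0 < n)%N -> exists u, [/\ n%:R <= u, u < n.+1%:R & `|lambda u| <= ell n]) ->
  (forall (d : R) X0, 0 < d -> ~ damped_large d X0 b) ->
  (\forall x \near +oo, 0 <= c * (psum R b (Num.truncn x) + lambda x)) ->
  exists C : R, mass_le C b.
Proof.
move=> c1 l0 lB lu hb [M [_ hM]].
pose n0 := (Num.truncn M).+1.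
have M0 : M < n0%:R by exact: truncnS_gt.
have [||C hC] := @summable_of_eventual_bound R (fun n => c * psum R b n) ell B n0 l0 _ lB.
- move=> n nn; have np : (0 < n)%N by apply: leq_trans nn.
  have [u [u1 u2 u3]] := lu n np.
  have Mu : M < u by apply: (lt_le_trans M0); apply: le_trans u1; rewrite ler_nat.
  have tu : Num.truncn u = n by apply: truncn_def; rewrite u1 u2.
  have := hM _ Mu; rewrite tu mulrDr.
  have : `|c * lambda u| <= ell n by rewrite normrM c1 mul1r.
  by rewrite ler_norml => /andP[_]; lra.
- move=> d X0 d0; apply: contrapT => hn; apply: (hb d X0 d0) => s X s1 s2 sd XX.
  rewrite ltNge; apply/negP => h; apply: hn; exists s, X; split => //.
  have -> : damped_sum (fun n => c * psum R b n) s X = c * damped_sum (psum R b) s X.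
    by rewrite /damped_sum mulr_sumr; apply: eq_bigr => n _; rewrite mulrA.
  by rewrite normrM c1 mul1r.
exists C => X; have := hC X; under eq_bigr do rewrite normrM c1 mul1r.
by [].
Qed.

End Perturbation.

(** * Almost sure sign changes from the exceptional null sets *)

Unset Implicit Arguments.
Set Strict Implicit.
Set Printing Implicit Defensive.

Theorem theorem2 (R : realType) (d : measure_display) (T : measurableType d)
    (P : probability T R) (f : nat -> {RV P >-> R})
    (hf : rademacher_rmf f)
    (lambda : R -> R)
    (hlambda : completed_lebesgue_measure.-integrable `[1, +oo[%classic
       (fun u : R => (`|lambda u| / u `^ (3 / 2))%:E)) :
  {ae P, forall t : T,
     changes_sign_io (fun x : R => summatory (fun n => f n t) x + lambda x)}.
Proof.
have [ell [B [l0 lB lu]]] := @perturbation_bound R lambda hlambda.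
(* Taking [d = 1 / (j + 1)] keeps the union countable; [damped_large] for some [d] implies it for
   every smaller one. *)
have N1 : P.-negligible (\bigcup_j \bigcup_X0
    [set t | damped_large (j.+1%:R^-1 : R) X0 (signs f t)]).
  apply: negligible_bigcup => j; apply: negligible_bigcup => X0.
  by apply: cylnull_negligible => //; apply: damped_large_cylnull; rewrite invr_gt0.
(* Integer bounds suffice, since [mass_le] weakens as [C] grows. *)
have N2 : P.-negligible (\bigcup_C [set t | mass_le (C%:R : R) (signs f t)]).
  apply: negligible_bigcup => C.
  by apply: cylnull_negligible => //; exact: mass_le_cylnull.
have N0 := rmf_signs_ae hf.
apply: negligibleS (negligibleU N0 (negligibleU N1 N2)) => t /= ht.
apply: contrapT => hg; apply: ht.
have ft n : (0 < n)%N -> f n t = rmf R (signs f t) n.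
  by move=> n0; apply: contrapT => e; apply: hg; left=> h; apply: e; exact: h.
have sE x : summatory (fun n => f n t) x = psum R (signs f t) (Num.truncn x).
  by rewrite /summatory /psum; apply: eq_big_nat => n /andP[n0 _]; exact: ft.
have hd (d0 : R) X0 : 0 < d0 -> ~ damped_large d0 X0 (signs f t).
  move=> d00 hdl; apply: hg; right; left.
  have [j _ hj] := near_infty_natSinv_lt (PosNum d00).
  exists j => //; exists X0 => // s X s1 s2 sj XX; apply: hdl => //.
  by apply: lt_trans sj _; rewrite ltrD2l; exact: (hj j (leqnn j)).
have hc (c : R) : `|c| = 1 ->
    ~ \forall x \near +oo, 0 <= c * (summatory (fun n => f n t) x + lambda x).
  move=> c1; under [X in ~ nbhs _ X]eq_fun do rewrite sE.
  move=> /(mass_le_of_eventual_sign c1 l0 lB lu hd)[C hC].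
  apply: hg; right; right; exists (Num.truncn C).+1 => // X.
  by apply: le_trans (hC X) _; apply/ltW/truncnS_gt.
split=> h; first by apply: (hc 1 (normr1 _)); apply: filterS h => x; rewrite mul1r.
apply: (hc (-1)); first by rewrite normrN normr1.
by apply: filterS h => x; rewrite mulN1r oppr_ge0.
Qed.
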